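(* Let $y\in W^{2,2}(\Omega,\mathbf{R}^{3})$ satisfy $(\nabla y)^{T}\nabla y=\mathcal{G}_{2\times2}$, let $b$ be its Cosserat vector, and write $H=\mathrm{sym}(\nabla y^{T}\nabla b)$. With $T_{2}^{*}(x')$, $n^{*}(x')$ and $R(x')$ as defined in the context (none of which depends on $y$), $T_2^*(x')$ is positive definite on $\mathbf{R}^{2\times 2}_{sym}$ for a.e. $x'$, and $$\mathcal{I}(y)=\frac12\int_{\Omega}\left\langle T_{2}^{*}(x')[H(x')-n^{*}(x')],\,H(x')-n^{*}(x')\right\rangle dx'+\frac12\int_{\Omega}R(x')\,dx'.$$ Moreover, for a.e. $x'\in\Omega$, $R(x')$ is the squared norm of $P(x',\cdot)$ minus its orthogonal projection onto the space of functions affine in $t$, i.e. $$R(x')=\min_{S_{0},S_{1}\in\mathbf{R}^{2\times2}_{sym}}\int_{-\frac12}^{\frac12}\left\langle L_{2}(x',t)[P(x',t)-S_{0}-tS_{1}],\,P(x',t)-S_{0}-tS_{1}\right\rangle dt,$$ where $P=\mathrm{sym}\left((\overline{A}B)_{2\times2}\right)$ and the inner product used for the projection is $\langle f,g\rangle=\int_{-1/2}^{1/2}\langle L_{2}(x',t)f(t),g(t)\rangle dt$.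
   Context: Setting. $\Omega\subset\mathbf{R}^{2}$ is open, bounded, connected with piecewise $C^{1}$ boundary, $\Omega^1=\Omega\times(-\frac12,\frac12)$, points of $\Omega^1$ are written $(x',t)$. $(M)_{2\times2}$ (or $M_{2\times2}$) is the upper-left $2\times2$ block of $M$; when a smaller matrix is added to a larger one, the smaller is viewed as the top-left block, with zeros elsewhere. $\nabla y,\nabla b$ are $3\times2$ matrices of partial derivatives. $\overline{A}\in C^{\infty}(\overline{\Omega},\mathbf{R}^{3\times3}_{sym,pos})$ (symmetric positive definite), $B\in L^{\infty}(\Omega^{1},\mathbf{R}^{3\times3}_{sym})$, $\mathcal{G}=\overline{A}^{2}$. Assumptions on $W:\Omega^{1}\times\mathbf{R}^{3\times3}\to\mathbf{R}$: (i) for a.e. $x$, $W(x,F)=W(x,RF)$ for all $F\in\mathbf{R}^{3\times3}$, $R\in SO(3)$; (ii) for a.e. $x$, $W(x,\cdot)$ is minimized at $SO(3)$ and the minimum is $0$; (iii) there is a constant $c>0$ independent of $x$ with $W(x,F)\ge c\,\mathrm{dist}^{2}(F,SO(3))$; (iv) there is a neighborhood $\mathcal U$ of $SO(3)$ such that for all $x\in\Omega^1$, $W(x,\cdot)$ is $C^{2}$ on $\mathcal U$, and $D^{2}W(x,\cdot)$ is uniformly equicontinuous on $\mathcal U$, uniformly in $x$; (v) there is a constant $C$ with $Q_{3}(x,F)\le C|\mathrm{sym}F|^{2}$ for all $x\in\Omega^{1}$, where $Q_{3}(x,F)=D^{2}W(x,\mathrm{Id})(F,F)$. Cosserat vector: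 with $\nu=\frac{\partial_{1}y\times\partial_{2}y}{\|\partial_{1}y\times\partial_{2}y\|}$, $b=(\nabla y)(\mathcal{G}_{2\times2})^{-1}[\mathcal{G}_{1,3},\mathcal{G}_{2,3}]^{T}+\frac{\sqrt{\det\mathcal{G}}}{\sqrt{\det\mathcal{G}_{2\times2}}}\nu$. Limit functional. For $X\in\mathbf{R}^{2\times2}$, $Q_{2}(x',t,X)=\min_{d\in\mathbf{R}^{3}}Q_{3}\left(x',t,\overline{A}^{-1}(x')[X+d\otimes e_{3}]\overline{A}^{-1}(x')\right)$. For $y$ with $(\nabla y)^{T}\nabla y=\mathcal{G}_{2\times2}$, $$\mathcal{I}(y)=\frac12\int_{\Omega}\min_{s\in\mathbf{R}^{2\times2}}\int_{-\frac12}^{\frac12}Q_{2}\left(x',t,\,t\nabla y^{T}\nabla b(x')-(\overline{A}(x')B(x',t))_{2\times2}+s\right)dt\,dx'.$$ Tensors. $Q_2(x',t,X)$ depends only on $\mathrm{sym}X$; let $L_{2}(x',t)$ be the self-adjoint linear map on $\mathbf{R}^{2\times2}_{sym}$ with $Q_{2}(x',t,X)=\langle L_{2}(x',t)X,X\rangle$ for $X\in\mathbf{R}^{2\times 2}_{sym}$. Let $L_{2}^{*}(x')=\int_{-1/2}^{1/2}L_{2}(x',t)dt$. For $X\in L^{2}((-\frac12,\frac12),\mathbf{R}^{2\times2}_{sym})$ let $\phi(x')(X)=(L_{2}^{*})^{-1}\int_{-1/2}^{1/2}L_{2}(x',t)X(t)dt$, and for $X\in\mathbf{R}^{2\times2}_{sym}$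 let $\phi_{1}(x')(X)=\phi(x')(tX)$. Set $V_{2}(x',t)=t\,\mathrm{Id}-\phi_{1}(x')$ (a linear map on $\mathbf{R}^{2\times2}_{sym}$, with adjoint $V_{2}^{T}$), $P=\mathrm{sym}((\overline{A}B)_{2\times2})$, $N_{1}(x',t)=P(x',t)-\phi(x')(P(x',\cdot))$, $T_{2}=V_{2}^{T}\circ L_{2}\circ V_{2}$, $T_{2}^{*}(x')=\int_{-1/2}^{1/2}T_{2}(x',t)dt$, $$n^{*}(x')=(T_{2}^{*})^{-1}\left(\int_{-\frac12}^{\frac12}V_{2}^{T}(x',t)L_{2}(x',t)N_{1}(x',t)\,dt\right),$$ $$R(x')=\int_{-\frac12}^{\frac12}\langle L_{2}N_{1},N_{1}\rangle dt-\int_{-\frac12}^{\frac12}\langle T_{2}n^{*},n^{*}\rangle dt.$$ *)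

(* Defs.v *)
From HB Require Import structures.
From mathcomp Require Import all_boot all_order all_algebra.
From mathcomp Require Import all_classical all_reals all_analysis.

Set Implicit Arguments.
Unset Strict Implicit.
Unset Printing Implicit Defensive.

Import Order.TTheory GRing.Theory Num.Theory numFieldNormedType.Exports.

Local Open Scope classical_set_scope.
Local Open Scope ring_scope.

Section Measures.
Context {R : realType}.

Definition leb1 : {measure set (measurableTypeR R) -> \bar R} :=
  lebesgue_measure.

Definition leb2 :
    {measure set (measurableTypeR R * measurableTypeR R)%type -> \bar R} :=
  (lebesgue_measure \x lebesgue_measure)%E.

Definition leb3 :
    {measure set (measurableTypeR R * measurableTypeR R * measurableTypeR R)%type
     -> \bar R} :=
  (leb2 \x lebesgue_measure)%E.

Definition thickness : set R := `](- 2^-1), 2^-1[.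

Definition plate (Om : set (R * R)) : set (R * R * R) := Om `*` thickness.

End Measures.

Section Minimum.
Context {R : realType}.

Definition is_minimum (S : set R) (m : R) := S m /\ lbound S m.

(* Total version: 0 when S has no least element. *)
Definition minimum (S : set R) : R := xget 0 (is_minimum S).

End Minimum.

Section Matrices.
Context {R : realType}.

(* The Frobenius inner product and norm; note that `|_| is the sup norm. *)
Definition mxdot m n (X Y : 'M[R]_(m, n)) : R := \tr (X^T *m Y).
Definition frob m n (X : 'M[R]_(m, n)) : R := Num.sqrt (mxdot X X).

Definition sympart n (X : 'M[R]_n) : 'M[R]_n := 2^-1 *: (X + X^T).

Definition sym_mx n (X : 'M[R]_n) := X^T = X.

Definition sympos_mx n (X : 'M[R]_n) :=
  sym_mx X /\ forall v : 'cV[R]_n, v != 0 -> 0 < mxdot v (X *m v).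

Definition SO3 : set 'M[R]_3 := [set Q | Q^T *m Q = 1%:M /\ \det Q = 1].

Definition distSO3 (F : 'M[R]_3) : R := inf [set frob (F - Q) | Q in SO3].

(* (M)_{2x2}, [M_13, M_23]^T and the embedding of 2x2 into 3x3 matrices *)
Definition ul2 (M : 'M[R]_3) : 'M[R]_2 := @ulsubmx R 2 1 2 1 M.
Definition ur2 (M : 'M[R]_3) : 'cV[R]_2 := @ursubmx R 2 1 2 1 M.
Definition pad3 (X : 'M[R]_2) : 'M[R]_3 := @block_mx R 2 1 2 1 X 0 0 0.

Definition e3 : 'cV[R]_3 := delta_mx ord_max 0.
Definition tensor3 (a b : 'cV[R]_3) : 'M[R]_3 := a *m b^T.

Definition cross (u v : 'cV[R]_3) : 'cV[R]_3 :=
  let a (i : nat) := u (inord i) 0 in let b (i : nat) := v (inord i) 0 in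
  \col_(i < 3) nth 0 [:: a 1%N * b 2%N - a 2%N * b 1%N;
                         a 2%N * b 0%N - a 0%N * b 2%N;
                         a 0%N * b 1%N - a 1%N * b 0%N] i.

End Matrices.

Section Smoothness.
Context {R : realType}.
Implicit Types (U : set (R * R)) (f g : R * R -> R).

Definition dir (i : 'I_2) : R * R := if i == ord0 then (1, 0) else (0, 1).

Definition partial (i : 'I_2) f : R * R -> R := fun x => 'D_(dir i) f x.

Definition partials (s : seq 'I_2) f : R * R -> R := foldr partial f s.

(* f is of class C^infinity on the open set U *)
Definition smooth_on U f := forall (s : seq 'I_2) x, U x ->
  {for x, continuous (partials s f)} /\
  forall i, derivable (partials s f) x (dir i).

(* f is of class C^infinity up to the boundary: smooth on U, with all the
   partial derivatives extending continuously to the closure of U *)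
Definition smooth_upto U f :=
  [/\ {within closure U, continuous f}, smooth_on U f &
      forall s : seq 'I_2, exists g : R * R -> R,
        {within closure U, continuous g} /\
        forall x, U x -> g x = partials s f x].

Definition test_fun U f :=
  [/\ smooth_on setT f, compact (closure [set x | f x != 0]) &
      closure [set x | f x != 0] `<=` U].

(* g : R -> R^2 is of class C^1 on the line *)
Definition C1_curve (g : R -> R * R) :=
  (forall t, derivable g t 1) /\ continuous (fun t => 'D_1 g t).

(* C is a Jordan curve with a parametrization by [0, 1] that is regular of
   class C^1 on each closed piece [tau k, tau k.+1] of a finite partition *)
Definition piecewise_C1_Jordan (C : set (R * R)) :=
  exists c : R -> R * R,
  [/\ C = c @` `[0, 1],
      c 0 = c 1,
      {in `[0, 1[ &, injective c} &
      exists (n : nat) (tau : nat -> R),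
      [/\ tau 0%N = 0, tau n = 1 &
          forall k, (k < n)%N -> tau k < tau k.+1 /\
          exists g : R -> R * R, C1_curve g /\
            forall t, tau k <= t <= tau k.+1 -> c t = g t /\ 'D_1 g t != 0]].

Definition piecewise_C1_boundary U :=
  exists (m : nat) (C : 'I_m -> set (R * R)),
  [/\ forall k, piecewise_C1_Jordan (C k),
      trivIset setT C &
      closure U `\` interior U = \bigcup_k C k].

End Smoothness.

Section WeakDerivatives.
Context {R : realType}.
Variable Om : set (R * R).
Implicit Types f g : R * R -> R.

Definition loc_int f :=
  measurable_fun (Om : set (measurableTypeR R * measurableTypeR R)%type) f /\
  forall K, compact K -> K `<=` Om ->
    leb2.-integrable K (EFin \o f).

Definition is_weak_partial (i : 'I_2) f g :=
  [/\ loc_int f, loc_int g &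
      forall p, test_fun Om p ->
        \int[leb2]_(x in Om) (f x * partial i p x) =
        - \int[leb2]_(x in Om) (g x * p x)].

(* A representative of the i-th weak derivative of f; 0 if there is none. *)
Definition wpartial (i : 'I_2) f : R * R -> R :=
  xget (fun=> 0) (is_weak_partial i f).

Definition in_L2 f := f \_ Om \in Lfun leb2 2%:E.

Definition in_W22 f :=
  in_L2 f /\
  forall i, exists g, [/\ is_weak_partial i f g, in_L2 g &
    forall j, exists h, is_weak_partial j g h /\ in_L2 h].

Definition in_W22_R3 (y : R * R -> 'cV[R]_3) :=
  forall k, in_W22 (fun x => y x k 0).

Definition grad (y : R * R -> 'cV[R]_3) (x : R * R) : 'M[R]_(3, 2) :=
  \matrix_(k, i) wpartial i (fun z => y z k 0) x.

End WeakDerivatives.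

Section Energy.
Context {R : realType}.
Variables (Om : set (R * R)) (W : R * R * R -> 'M[R]_3 -> R).

(* D^2 W(x, F)(X, Y) *)
Definition D2W (x : R * R * R) (F X Y : 'M[R]_3) : R :=
  'D_Y (fun F' : 'M[R]_3 => 'D_X (W x) F') F.

Definition Q3 (x : R * R * R) (F : 'M[R]_3) : R := D2W x 1%:M F F.

Definition C2_on (U : set 'M[R]_3) (x : R * R * R) :=
  (forall F, U F -> {for F, continuous (W x)}) /\
  forall X F, U F ->
  [/\ derivable (W x) F X,
      {for F, continuous (fun F' : 'M[R]_3 => 'D_X (W x) F')} &
      forall Y, derivable (fun F' : 'M[R]_3 => 'D_X (W x) F') F Y /\
                {for F, continuous (fun F' => D2W x F' X Y)}].

(* Borel measurability of W(., F) is what gives a meaning to the integrals of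
   quantities built from D^2 W(., Id). *)
Definition admissible :=
  (forall F, measurable_fun
      (plate Om : set (measurableTypeR R * measurableTypeR R
                       * measurableTypeR R)%type) (W^~ F)) /\
  [/\ {ae leb3, forall x, plate Om x ->
        forall F Q, SO3 Q -> W x F = W x (Q *m F)},
      {ae leb3, forall x, plate Om x ->
        (forall F, 0 <= W x F) /\ (forall Q, SO3 Q -> W x Q = 0)},
      (exists2 c : R, 0 < c & {ae leb3, forall x, plate Om x ->
        forall F, c * distSO3 F ^+ 2 <= W x F}),
      (exists U : set 'M[R]_3,
        [/\ open U, SO3 `<=` U,
            forall x, plate Om x -> C2_on U x &
            forall e : R, 0 < e -> exists2 d : R, 0 < d &
              forall x F G, plate Om x -> U F -> U G -> frob (F - G) < d ->
              forall X Y,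
                `|D2W x F X Y - D2W x G X Y| <= e * frob X * frob Y]) &
      (exists C : R, forall x F, plate Om x ->
        Q3 x F <= C * frob (sympart F) ^+ 2)].

End Energy.

Section LimitFunctional.
Context {R : realType}.
Variables (Om : set (R * R)) (W : R * R * R -> 'M[R]_3 -> R)
  (A : R * R -> 'M[R]_3) (B : R * R * R -> 'M[R]_3).

Definition metric (x : R * R) : 'M[R]_3 := A x *m A x.

Definition nu (y : R * R -> 'cV[R]_3) (x : R * R) : 'cV[R]_3 :=
  let n := cross (col 0 (grad Om y x)) (col 1 (grad Om y x)) in
  (frob n)^-1 *: n.

Definition cosserat (y : R * R -> 'cV[R]_3) (x : R * R) : 'cV[R]_3 :=
  grad Om y x *m invmx (ul2 (metric x)) *m ur2 (metric x)
  + (Num.sqrt (\det (metric x)) / Num.sqrt (\det (ul2 (metric x)))) *: nu y x.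

Definition Q2 (x : R * R) (t : R) (X : 'M[R]_2) : R :=
  minimum [set Q3 W (x, t)
                 (invmx (A x) *m (pad3 X + tensor3 d e3) *m invmx (A x))
          | d in [set: 'cV[R]_3]].

(* The integral over Om is taken in the extended reals, the integrand being
   nonnegative almost everywhere for an admissible W. *)
Definition energy (y : R * R -> 'cV[R]_3) : \bar R :=
  ((2^-1)%:E * \int[leb2]_(x in Om)
    (minimum [set \int[leb1]_(t in thickness)
        Q2 x t (t *: ((grad Om y x)^T *m grad Om (cosserat y) x)
                - ul2 (A x *m B (x, t)) + s)
     | s in [set: 'M[R]_2]])%:E)%E.

End LimitFunctional.

Section Sym2.
Context {R : realType}.

Definition symv : {vspace 'M[R]_2} :=
  lker (linfun (fun X : 'M[R]_2 => X^T - X)).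
Definition sym2 := subvs_of symv.

Definition to_sym2 (X : 'M[R]_2) : sym2 := vsproj symv (sympart X).

Definition dot2 (X Y : sym2) : R := mxdot (vsval X) (vsval Y).

Definition selfadjoint (L : 'End(sym2)) :=
  forall X Y, dot2 (L X) Y = dot2 X (L Y).

Definition posdef (L : 'End(sym2)) :=
  selfadjoint L /\ forall X, X != 0 -> 0 < dot2 (L X) X.

(* The set is a singleton, dot2 being an inner product. *)
Definition adjoint (V : 'End(sym2)) : 'End(sym2) :=
  xget 0 [set V' : 'End(sym2) | forall X Y, dot2 (V' X) Y = dot2 X (V Y)].

(* integrals over (-1/2, 1/2) of maps into R^{2x2}_sym (entrywise) and into
   its endomorphisms (pointwise) *)
Definition int_sym2 (f : R -> sym2) : sym2 :=
  to_sym2 (\matrix_(i, j) \int[leb1]_(t in thickness) (vsval (f t)) i j).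
Definition int_End (L : R -> 'End(sym2)) : 'End(sym2) :=
  linfun (fun X : sym2 => int_sym2 (fun t => L t X)).

End Sym2.

Arguments sym2 : clear implicits.

Section Tensors.
Context {R : realType}.
Variables (W : R * R * R -> 'M[R]_3 -> R)
  (A : R * R -> 'M[R]_3) (B : R * R * R -> 'M[R]_3).
Implicit Types (x : R * R) (t : R).

(* The operator representing the quadratic form Q2 on symmetric matrices; it
   exists, and is unique, wherever this restriction of Q2 is quadratic. *)
Definition L2 x t : 'End(sym2 R) :=
  xget 0 [set L : 'End(sym2 R) | selfadjoint L /\
    forall X, Q2 W A x t (vsval X) = dot2 (L X) X].

(* (_^-1)%VF below is the inverse wherever the operator is invertible. *)
Definition L2star x : 'End(sym2 R) := int_End (L2 x).

Definition phi x (X : R -> sym2 R) : sym2 R :=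
  ((L2star x)^-1)%VF (int_sym2 (fun t => L2 x t (X t))).

Definition phi1 x : 'End(sym2 R) :=
  linfun (fun X : sym2 R => phi x (fun t => t *: X)).

Definition V2 x t : 'End(sym2 R) := t *: \1%VF - phi1 x.

Definition P x t : sym2 R := to_sym2 (ul2 (A x *m B (x, t))).

Definition N1 x t : sym2 R := P x t - phi x (P x).

Definition T2 x t : 'End(sym2 R) :=
  (adjoint (V2 x t) \o L2 x t \o V2 x t)%VF.

Definition T2star x : 'End(sym2 R) := int_End (T2 x).

Definition nstar x : sym2 R :=
  ((T2star x)^-1)%VF
    (int_sym2 (fun t => adjoint (V2 x t) (L2 x t (N1 x t)))).

(* the remainder R(x') *)
Definition Rem x : R :=
  \int[leb1]_(t in thickness) dot2 (L2 x t (N1 x t)) (N1 x t)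
  - \int[leb1]_(t in thickness) dot2 (T2 x t (nstar x)) (nstar x).

(* the inner product <f, g> = int <L2 f, g> dt used for the projection *)
Definition dotL2 x (f g : R -> sym2 R) : R :=
  \int[leb1]_(t in thickness) dot2 (L2 x t (f t)) (g t).

Definition affine (S0 S1 : sym2 R) : R -> sym2 R := fun t => S0 + t *: S1.

(* g is the dotL2-orthogonal projection of f onto the affine functions *)
Definition affine_proj x (f g : R -> sym2 R) :=
  (exists S0 S1, g = affine S0 S1) /\
  forall S0 S1, dotL2 x (f \- g) (affine S0 S1) = 0.

End Tensors.

Section Hessian.
Context {R : realType}.

Definition Hsym (Om : set (R * R)) (A : R * R -> 'M[R]_3)
    (y : R * R -> 'cV[R]_3) (x : R * R) : sym2 R :=
  to_sym2 ((grad Om y x)^T *m grad Om (cosserat Om A y) x).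

End Hessian.

(* Main.v *)
Require Import Defs.
From HB Require Import structures.
From mathcomp Require Import all_boot all_order all_algebra.
From mathcomp Require Import all_classical all_reals all_analysis.
From mathcomp Require Import measurable_realfun ess_sup_inf ring lra.
Import Order.TTheory GRing.Theory Num.Theory numFieldNormedType.Exports.
Local Open Scope classical_set_scope.
Local Open Scope ring_scope.

Set Implicit Arguments.
Unset Strict Implicit.
Unset Printing Implicit Defensive.

(** For fixed x' equip the functions of t with the inner product
<f, g> = int <L2 f, g> dt. In this language phi is the orthogonal projection
onto the constants, V2 X is what remains of t X after it, N1 is what remains
of P, and T2* is the Gram operator <T2* X, Y> = <V2 X, V2 Y>. The equation
that defines n* says that V2 n* is the projection of N1 onto the functions
V2 X. Hence r = N1 - V2 n* is the difference between P and its projection onto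
the affine functions, its squared norm is R (RemE), and T2* is positive
definite because an affine function of t vanishes at most once unless it is
zero (qf_affine_gt0). The function t H - P + s is the sum of the three mutually
orthogonal functions - r, V2 (H - n* ) and the constant s - s0, where
s0 = phi(P) - phi1(H); so its squared norm is
   <T2* (H - n* ), H - n*> + R + <L2* (s - s0), s - s0>   (dotL2_split)
and minimizing over s drops the last term. Integration over Omega gives the
formula for the energy.

Three facts make this rigorous. First, Q2 is a positive definite quadratic form
on symmetric matrices at almost every point (L2_spec). The second derivative of
W at the identity is bilinear, which the mean value theorem on lines extracts
from the continuity of the directional derivatives (derive_linear). It is
definite on symmetric matrices because dist(1 + h G, SO(3)) is at least
proportional to h when sym G is not zero (distSO3_lower_bound, hess_gt0), and
it ignores skew-symmetric matrices because of the upper bound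
(hess_sympart). Minimizing over d is again an orthogonal projection
(form_projection, Q2_form). Second, the hypotheses hold only outside null sets,
where nothing is known about L2, not even its measurability; by
integral_setD_null, a null set can be removed from the domain of the integral
of an arbitrary function. Third, splitting the integral over Omega
requires measurable integrands. Every minimum that occurs is that of a completed
square, hence the infimum over countably many rational points, and
minima of measurable families are measurable (measurable_minimum). This applies
to Q2, to the energy density and to R, which is the least energy density over
all H; the term with T2* is the difference of the last two. *)

(** * Symmetric bilinear forms *)

Section SymmetricForms.
Context {R : realType} {V : lmodType R}.
Implicit Types (b : V -> V -> R) (u v w : V).

Definition symform b :=
  (forall u v, b u v = b v u) /\
  (forall a u v w, b (a *: u + v) w = a * b u w + b v w).

Variable b : V -> V -> R.
Hypothesis hb : symform b.

Lemma formC u v : b u v = b v u. Proof. exact: hb.1. Qed.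

Lemma formDl u v w : b (u + v) w = b u w + b v w.
Proof. by rewrite -[u]scale1r hb.2 mul1r scale1r. Qed.

Lemma form0l w : b 0 w = 0.
Proof. by apply: (addrI (b 0 w)); rewrite -formDl !addr0. Qed.

Lemma formZl a u w : b (a *: u) w = a * b u w.
Proof. by rewrite -[a *: u]addr0 hb.2 form0l addr0. Qed.

Lemma formNl u w : b (- u) w = - b u w.
Proof. by rewrite -scaleN1r formZl mulN1r. Qed.

Lemma formBl u v w : b (u - v) w = b u w - b v w.
Proof. by rewrite formDl formNl. Qed.

Lemma formDr u v w : b w (u + v) = b w u + b w v.
Proof. by rewrite formC formDl !(formC w). Qed.

Lemma form0r w : b w 0 = 0. Proof. by rewrite formC form0l. Qed.

Lemma formZr a u w : b w (a *: u) = a * b w u.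
Proof. by rewrite formC formZl formC. Qed.

Lemma formNr u w : b w (- u) = - b w u.
Proof. by rewrite formC formNl formC. Qed.

Lemma form_suml I (r : seq I) (P : pred I) (F : I -> V) w :
  b (\sum_(i <- r | P i) F i) w = \sum_(i <- r | P i) b (F i) w.
Proof. by apply: (big_morph (b ^~ w)); [move=> *; exact: formDl|exact: form0l]. Qed.

Lemma form_sumr I (r : seq I) (P : pred I) (F : I -> V) w :
  b w (\sum_(i <- r | P i) F i) = \sum_(i <- r | P i) b w (F i).
Proof. by rewrite formC form_suml; apply: eq_bigr => i _; rewrite formC. Qed.

Lemma form_sqrD u v : b (u + v) (u + v) = b u u + 2 * b u v + b v v.
Proof. by rewrite formDl !formDr (formC v u) mulr_natl mulr2n !addrA. Qed.

Lemma form_pythagoras u v : b u v = 0 -> b (u + v) (u + v) = b u u + b v v.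
Proof. by move=> uv; rewrite form_sqrD uv mulr0 addr0. Qed.

Lemma form_pythagorasN u v : b u v = 0 -> b (- u + v) (- u + v) = b u u + b v v.
Proof.
by move=> uv; rewrite form_sqrD !formNl formNr uv opprK oppr0 mulr0 addr0.
Qed.

Lemma form_residual u v : b v v = b u v -> b (u - v) (u - v) = b u u - b v v.
Proof. by move=> E; rewrite form_sqrD formNr formNl formNr opprK -E; ring. Qed.

Lemma polarization u v : b u v = 4^-1 * (b (u + v) (u + v) - b (u - v) (u - v)).
Proof.
rewrite !form_sqrD formNr formNl formNr opprK; field; exact: isT.
Qed.

(** If b k v were not zero, s |-> b (v + s k) (v + s k) would be a nonconstant
affine function, hence negative somewhere. *)
Lemma form_kernel k v : (forall u, 0 <= b u u) -> b k k = 0 -> b k v = 0.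
Proof.
move=> b0 bk; apply/eqP; apply: contraT => bkv.
have := b0 (v + (- (b v v + 1) / (2 * b k v)) *: k).
rewrite form_sqrD !formZr formZl bk !mulr0 addr0 (formC v k).
have -> : 2 * (- (b v v + 1) / (2 * b k v) * b k v) = - (b v v + 1) by field.
move=> ?; lra.
Qed.

Lemma form_add_kernel k v : (forall u, 0 <= b u u) -> b k k = 0 ->
  b (v + k) (v + k) = b v v.
Proof.
by move=> b0 bk; rewrite form_sqrD bk (formC v) (form_kernel v b0 bk) mulr0 !addr0.
Qed.

End SymmetricForms.

Lemma symform_symmetrize (R : realType) (V : lmodType R) (B : V -> V -> R) :
  (forall a u v w, B (a *: u + v) w = a * B u w + B v w) ->
  (forall a u v w, B w (a *: u + v) = a * B w u + B w v) ->
  symform (fun u v => 2^-1 * (B u v + B v u)).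
Proof.
by move=> Bl Br; split=> [u v|a u v w]; [rewrite addrC|rewrite Bl Br; ring].
Qed.

(** The coefficients of the projection onto the range of j solve a linear system whose matrix is
the Gram matrix of the columns of j, invertible as b is definite on them. *)
Lemma form_projection (R : realType) (V : lmodType R) (b : V -> V -> R) n
    (j : {linear 'cV[R]_n -> V}) :
  symform b -> (forall d, d != 0 -> 0 < b (j d) (j d)) ->
  exists p : V -> 'cV[R]_n,
    (forall a u v, p (a *: u + v) = a *: p u + p v) /\
    forall v d, b (v - j (p v)) (j d) = 0.
Proof.
move=> hb bpos.
pose e k : 'cV[R]_n := delta_mx k 0.
have jE d : j d = \sum_k d k 0 *: j (e k).
  rewrite {1}[d]matrix_sum_delta linear_sum; apply: eq_bigr => k _.
  by rewrite big_ord1 linearZ.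
pose M := \matrix_(i, k) b (j (e i)) (j (e k)).
have bjE v d : b v (j d) = ((\row_k b v (j (e k))) *m d) 0 0.
  rewrite jE (form_sumr hb) mxE; apply: eq_bigr => k _.
  by rewrite (formZr hb) mxE mulrC.
have ME d : (\row_k b (j d) (j (e k))) = d^T *m M.
  apply/rowP => k; rewrite !mxE jE (form_suml hb); apply: eq_bigr => i _.
  by rewrite (formZl hb) !mxE.
have Mu : M \in unitmx.
  rewrite -row_free_unit; apply: inj_row_free => v vM.
  have [//|vN0] := eqVneq v 0.
  have /bpos : v^T != 0 by apply: contra vN0 => /eqP /(congr1 trmx); rewrite trmxK trmx0 => ->.
  by rewrite bjE ME trmxK vM mul0mx mxE ltxx.
exists (fun v => ((\row_k b v (j (e k))) *m invmx M)^T); split => [a u v|v d].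
  rewrite -linearZ -linearD/= scalemxAl -mulmxDl; congr (_ *m _)^T.
  by apply/rowP => k; rewrite !mxE hb.2.
rewrite (formBl hb) !bjE ME trmxK mulmxKV//; exact: subrr.
Qed.

(** * Symmetric matrices *)

Section Sym2Theory.
Context {R : realType}.
Implicit Types (X Y : sym2 R) (M N : 'M[R]_2).

Lemma mxdotE m n (M N : 'M[R]_(m, n)) : mxdot M N = \sum_i \sum_j M i j * N i j.
Proof.
rewrite /mxdot /mxtrace exchange_big/=; apply: eq_bigr => j _.
by rewrite mxE; apply: eq_bigr => i _; rewrite mxE.
Qed.

Lemma symform_mxdot m n : symform (@mxdot R m n).
Proof.
split=> [u v|a u v w]; rewrite !mxdotE.
  by apply: eq_bigr => i _; apply: eq_bigr => j _; rewrite mulrC.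
rewrite mulr_sumr -big_split/=; apply: eq_bigr => i _.
rewrite mulr_sumr -big_split/=; apply: eq_bigr => j _.
by rewrite !mxE mulrDl mulrA.
Qed.

Lemma mxdot_ge0 m n (M : 'M[R]_(m, n)) : 0 <= mxdot M M.
Proof. by rewrite mxdotE; do 2!apply: sumr_ge0 => ? _; rewrite -expr2 sqr_ge0. Qed.

Lemma mxdot_eq0 m n (M : 'M[R]_(m, n)) : mxdot M M = 0 -> M = 0.
Proof.
rewrite mxdotE => /eqP; rewrite psumr_eq0; last first.
  by move=> i _; apply: sumr_ge0 => j _; rewrite -expr2 sqr_ge0.
move=> /allP h; apply/matrixP => i j; rewrite mxE; apply/eqP.
have /h/= := mem_index_enum i; rewrite psumr_eq0; last first.
  by move=> k _; rewrite -expr2 sqr_ge0.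
by move=> /allP/(_ j (mem_index_enum j))/=; rewrite mulf_eq0 orbb.
Qed.

Lemma linfun_linearE (aT rT : vectType R) (f : aT -> rT) :
  linear f -> linfun f =1 f.
Proof.
move=> lf x.
pose ff : {linear aT -> rT} :=
  HB.pack f (@GRing.isLinear.Build R aT rT *:%R f lf).
exact: (lfunE ff x).
Qed.

Lemma symvE M : (M \in symv) = (M^T == M).
Proof.
rewrite memv_ker linfun_linearE/= ?subr_eq0// => a u v.
by rewrite linearP/= scalerBr opprD addrACA.
Qed.

Lemma sym2_tr X : (vsval X)^T = vsval X.
Proof. by apply/eqP; rewrite -symvE subvsP. Qed.

Lemma sympart_sym n (M : 'M[R]_n) : (sympart M)^T = sympart M.
Proof. by rewrite /sympart linearZ linearD/= trmxK addrC. Qed.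

Lemma sympartP n : linear (@sympart R n).
Proof.
by move=> a u v; apply/matrixP => i j; rewrite !mxE; ring.
Qed.

Lemma vsval_to_sym2 M : vsval (to_sym2 M) = sympart M.
Proof. by rewrite vsprojK// symvE sympart_sym. Qed.

Lemma sympart_id n (M : 'M[R]_n) : M^T = M -> sympart M = M.
Proof.
by move=> h; rewrite /sympart h; apply/matrixP => i j; rewrite !mxE; field.
Qed.

Lemma to_sym2K X : to_sym2 (vsval X) = X.
Proof. by apply: val_inj; rewrite /= vsval_to_sym2 sympart_id ?sym2_tr. Qed.

Lemma to_sym2P : linear (@to_sym2 R).
Proof.
by move=> a u v; apply: val_inj; rewrite !linearP/= !vsval_to_sym2 sympartP.
Qed.

Lemma mxdot_sympart n (M N : 'M[R]_n) : N^T = N ->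
  mxdot (sympart M) N = mxdot M N.
Proof.
move=> hN; rewrite (formZl (symform_mxdot _ _)) (formDl (symform_mxdot _ _)).
have -> : mxdot M^T N = mxdot M N.
  by rewrite /mxdot trmxK -mxtrace_tr trmx_mul hN mxtrace_mulC.
by field.
Qed.

Lemma dot2_to_sym2 M Y : dot2 (to_sym2 M) Y = mxdot M (vsval Y).
Proof. by rewrite /dot2 vsval_to_sym2 mxdot_sympart ?sym2_tr. Qed.

Lemma symform_dot2 : symform (@dot2 R).
Proof.
split=> [u v|a u v w]; first exact: (symform_mxdot _ _).1.
by rewrite /dot2 linearP (symform_mxdot _ _).2.
Qed.

Lemma dot2_gt0 X : X != 0 -> 0 < dot2 X X.
Proof.
move=> X0; rewrite lt_neqAle mxdot_ge0 andbT eq_sym.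
apply: contra X0 => /eqP/mxdot_eq0 h; apply/eqP/val_inj; rewrite /= h.
exact: esym (linear0 (vsval : {linear sym2 R -> 'M[R]_2})).
Qed.

Lemma dot2_inj X Y : (forall Z, dot2 X Z = dot2 Y Z) -> X = Y.
Proof.
move=> h; apply/eqP; rewrite -subr_eq0; apply: contraT => /dot2_gt0.
by rewrite {1}/dot2 -/(dot2 _ _) (formBl symform_dot2) h subrr ltxx.
Qed.

(** These generate the symmetric matrices and, paired with X by dot2, give its
entries. *)
Definition sdelta (i j : 'I_2) : sym2 R := to_sym2 (delta_mx i j).

Lemma dot2_sdelta X i j : dot2 X (sdelta i j) = vsval X i j.
Proof.
rewrite (formC symform_dot2) dot2_to_sym2 mxdotE (bigD1 i)//= (bigD1 j)//=.
rewrite mxE !eqxx mul1r [X in _ + X + _]big1 => [|k kj]; last first.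
  by rewrite mxE (negPf kj) andbF mul0r.
rewrite big1 ?addr0// => k ki; rewrite big1// => l _.
by rewrite mxE (negPf ki) mul0r.
Qed.

Lemma to_sym2_sum_delta M : to_sym2 M = \sum_i \sum_j M i j *: sdelta i j.
Proof.
rewrite -(linfun_linearE to_sym2P) {1}[M]matrix_sum_delta linear_sum.
apply: eq_bigr => i _; rewrite linear_sum; apply: eq_bigr => j _.
by rewrite linearZ /= linfun_linearE//; exact: to_sym2P.
Qed.

Lemma sym2_sum_delta X : X = \sum_i \sum_j vsval X i j *: sdelta i j.
Proof. by rewrite -to_sym2_sum_delta to_sym2K. Qed.

(** Riesz representation, by symmetrizing the matrix of the values of b X. *)
Lemma dot2_representation (b : sym2 R -> sym2 R -> R) :
  (forall a u v w, b (a *: u + v) w = a * b u w + b v w) ->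
  (forall a u v w, b w (a *: u + v) = a * b w u + b w v) ->
  exists L : 'End(sym2 R), forall X Y, dot2 (L X) Y = b X Y.
Proof.
move=> bl br.
pose f X := to_sym2 (\matrix_(i, j) b X (sdelta i j)).
have lf : linear f.
  move=> a u v; rewrite -to_sym2P; congr to_sym2.
  by apply/matrixP => i j; rewrite !mxE bl.
exists (linfun f) => X Y; rewrite linfun_linearE// dot2_to_sym2 mxdotE.
have b0 w : b w 0 = 0.
  by have /eqP := br 1 0 0 w; rewrite scaler0 addr0 mul1r -subr_eq subrr => /eqP.
have bZ a u w : b w (a *: u) = a * b w u by rewrite -[a *: u]addr0 br b0 addr0.
have bD u v w : b w (u + v) = b w u + b w v.
  by rewrite -[u]scale1r br mul1r scale1r.
have bS (F : 'I_2 -> sym2 R) : b X (\sum_i F i) = \sum_i b X (F i).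
  by apply: (big_morph (b X)).
rewrite [in RHS](sym2_sum_delta Y) bS; apply: eq_bigr => i _.
by rewrite bS; apply: eq_bigr => j _; rewrite bZ mxE mulrC.
Qed.

Lemma symform_representation (b : sym2 R -> sym2 R -> R) : symform b ->
  exists L : 'End(sym2 R), selfadjoint L /\ forall X Y, dot2 (L X) Y = b X Y.
Proof.
move=> hb; have [L LE] := dot2_representation hb.2
  (fun a u v w => etrans (formDr hb _ _ _) (congr1 (+%R ^~ _) (formZr hb _ _ _))).
by exists L; split=> // X Y; rewrite (formC symform_dot2 X) !LE hb.1.
Qed.

Lemma adjointE (V : 'End(sym2 R)) X Y : dot2 (adjoint V X) Y = dot2 X (V Y).
Proof.
have [L LE] := @dot2_representation (fun X Y => dot2 X (V Y))
  (fun a u v w => symform_dot2.2 a u v (V w))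
  (fun a u v w => etrans (congr1 (dot2 w) (linearP V a u v))
     (etrans (formDr symform_dot2 _ _ _) (congr1 (+%R ^~ _) (formZr symform_dot2 _ _ _)))).
have : [set V' : 'End(sym2 R) | forall X Y, dot2 (V' X) Y = dot2 X (V Y)] L by [].
by move=> h; exact: (xgetI _ h).
Qed.

(** A positive definite operator is injective, hence invertible. *)
Lemma posdef_invK (L : 'End(sym2 R)) : (forall X, X != 0 -> 0 < dot2 (L X) X) ->
  cancel (L^-1)%VF L.
Proof.
move=> Lpos; apply: lker0_lfunVK; apply/lker0P => X Y LXY.
apply/eqP; rewrite -subr_eq0; apply: contraT => /Lpos.
have -> : L (X - Y) = 0 :> sym2 R by rewrite (linearB L); apply/eqP; rewrite subr_eq0; apply/eqP.
by rewrite (form0l symform_dot2) ltxx.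
Qed.

End Sym2Theory.

(** * Directional derivatives of functions of class C2 *)

Section DirectionalDerivatives.
Context {R : realType} {V : normedModType R}.
Implicit Types (f : V -> R) (F X Y : V).

Lemma is_derive_line f F X (s : R) : derivable f (F + s *: X) X ->
  is_derive s (1 : R) (fun r : R => f (F + r *: X)) ('D_X f (F + s *: X)).
Proof.
have E : (fun h : R => h^-1 *: (((fun r : R => f (F + r *: X)) \o shift s) (h *: (1 : R))
            - f (F + s *: X))) =
         (fun h : R => h^-1 *: ((f \o shift (F + s *: X)) (h *: X)
            - f (F + s *: X))).
  apply/funext => h /=; congr (_ *: (f _ - _)).
  by rewrite [h *: 1]mulr1 scalerDl addrCA.
by move=> df; split; [rewrite /derivable E|rewrite /derive E].
Qed.

(** The sign condition places the intermediate point on the same side as h: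
the second order estimate below needs it. *)
Lemma line_MVT f F X (h : R) :
  (forall s : R, `|s| <= `|h| -> derivable f (F + s *: X) X) ->
  exists2 s : R, (`|s| <= `|h|) && ((h != 0) ==> (0 < s * h)) & f (F + h *: X) - f F = h * 'D_X f (F + s *: X).
Proof.
move=> df; pose g (r : R) := f (F + r *: X).
have dg (s : R) : `|s| <= `|h| -> is_derive s (1 : R) g ('D_X f (F + s *: X)).
  by move=> sh; exact/is_derive_line/df.
have cg (a b : R) : `|a| <= `|h| -> `|b| <= `|h| -> {within `[a, b], continuous g}.
  move=> ah bh; apply: derivable_within_continuous => s; rewrite in_itv/= => /andP[as_ sb].
  apply: (@ex_derive _ _ _ _ _ _ _ (dg s _)).
  move: ah bh; rewrite !ler_norml => /andP[? ?] /andP[? ?].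
  by apply/andP; split; lra.
have [h0|h0|->] := ltgtP h 0; last first.
- by exists 0; rewrite ?normr0 ?mul0r ?lexx ?eqxx// scale0r addr0 subrr.
- have [|s|c] := @MVT R g (fun s => 'D_X f (F + s *: X)) 0 h h0.
  + move=> s; rewrite in_itv/= => /andP[s0 sh]; apply: dg.
    by rewrite !gtr0_norm// ltW.
  + by apply: cg => //; rewrite normr0.
  rewrite in_itv/= => /andP[c0 ch] E; exists c.
    by rewrite !gtr0_norm// (ltW ch)/= mulr_gt0// implybT.
  by move: E; rewrite /g scale0r addr0 subr0 mulrC.
- have [|s|c] := @MVT R g (fun s => 'D_X f (F + s *: X)) h 0 h0.
  + move=> s; rewrite in_itv/= => /andP[hs s0]; apply: dg.
    by rewrite !ltr0_norm// lerN2 ltW.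
  + by apply: cg => //; rewrite normr0.
  rewrite in_itv/= => /andP[hc c0] E; exists c.
    by rewrite !ltr0_norm// lerN2 (ltW hc)/= nmulr_rgt0// c0 implybT.
  move: E; rewrite /g scale0r addr0 sub0r mulrN mulrC => /(congr1 -%R).
  by rewrite opprB opprK.
Qed.

(** The increment of f along h (a X + Y) is the sum of the one along h Y and
the one along h a X; by the mean value theorem the latter is h a times a value
of the derivative along X that tends to the one at F. *)
Lemma derive_linear f F (U : set V) a X Y : open U -> U F ->
  (forall Z G, U G -> derivable f G Z) ->
  {for F, continuous (fun G => 'D_X f G)} ->
  'D_(a *: X + Y) f F = a * 'D_X f F + 'D_Y f F.
Proof.
move=> oU UF df cf.
pose q Z (h : R) := h^-1 *: ((f \o shift F) (h *: Z) - f F).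
have qc Z : q Z h @[h --> 0^'] --> 'D_Z f F by exact: df.
apply/eqP; rewrite -subr_eq; apply/eqP.
apply: (@cvg_unique _ (@Rhausdorff R) ((q (a *: X + Y) \- q Y) h @[h --> 0^'])).
  exact: (cvgB (qc _) (qc _)).
apply/cvgrPdist_le => e e0.
have /cvgrPdist_lt cf' : 'D_X f G @[G --> F] --> 'D_X f F by exact: cf.
have : \forall G \near F, U G /\ `|'D_X f F - 'D_X f G| < e / (`|a| + 1).
  near=> G; split; near: G; first exact: open_nbhs_nbhs.
  by apply: cf'; rewrite divr_gt0// ltr_wpDl.
case/nbhs_ballP => d /= d0 hd.
have hd' G : `|G| < d -> U (F + G) /\ `|'D_X f F - 'D_X f (F + G)| < e / (`|a| + 1).
  move=> Gd; apply: hd; rewrite -ball_normE/= opprD addrA subrr sub0r normrN//.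
pose m := `|Y| + `|a| * `|X| + 1.
have m0 : 0 < m by rewrite ltr_wpDl// addr_ge0// mulr_ge0.
near=> h.
have h0 : h != 0 by near: h; exact: nbhs_dnbhs_neq.
have hm : `|h| < d / m.
  near: h; apply: dnbhs0_lt; exact: divr_gt0.
have small (s : R) : `|s| <= `|h * a| -> `|h *: Y + s *: X| < d.
  move=> sh; apply: (le_lt_trans (ler_normD _ _)).
  rewrite !normrZ; apply: (@le_lt_trans _ _ (`|h| * m)).
    rewrite /m mulrDr mulr1 mulrDr -!addrA lerD2l; apply: ler_wpDr => //.
    by rewrite mulrA -normrM ler_wpM2r.
  by rewrite -ltr_pdivlMr.
have dfs (s : R) : `|s| <= `|h * a| -> derivable f (F + h *: Y + s *: X) X.
  by move=> sh; apply: df; rewrite -addrA; exact: (hd' _ (small s sh)).1.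
have [s /andP[sh _] E] := line_MVT dfs.
have qE : q (a *: X + Y) h - q Y h = a * 'D_X f (F + (h *: Y + s *: X)).
  rewrite /= /q /= -scalerBr.
  have -> : h *: (a *: X + Y) + F = F + h *: Y + (h * a) *: X.
    by rewrite scalerDr scalerA addrC [(h * a) *: X + _]addrC addrA.
  rewrite [h *: Y + F]addrC.
  have -> : f (F + h *: Y + (h * a) *: X) - f F - (f (F + h *: Y) - f F) =
     f (F + h *: Y + (h * a) *: X) - f (F + h *: Y) by ring.
  by rewrite E /GRing.scale/= -mulrA mulKf// addrA.
rewrite -[X in `|X|]/(a * 'D_X f F - (q (a *: X + Y) h - q Y h)) qE -mulrBr normrM.
have /ltW le2 := (hd' _ (small s sh)).2.
apply: (@le_trans _ _ (`|a| * (e / (`|a| + 1)))); first by rewrite ler_wpM2l.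
rewrite mulrCA; apply: ler_piMr; first exact: ltW.
by rewrite ler_pdivrMr ?mul1r ?lerDl// ltr_wpDl.
Unshelve. all: by end_near. Qed.

(** At its minimum point F both f and its first derivatives vanish. So with D2
the second derivative along X, the mean value theorem bounds f (F + h X) by
(D2 + e) h^2 for small h > 0, and comparison with k h^2 gives k <= D2 + e. *)
Lemma second_derive_lower_bound f F (U : set V) X k : open U -> U F ->
  (forall G, U G -> derivable f G X) ->
  derivable (fun G => 'D_X f G) F X ->
  f F = 0 -> (forall G, 0 <= f G) -> 0 <= k ->
  (\forall h \near 0^', k * h ^+ 2 <= f (F + h *: X)) ->
  k <= 'D_X (fun G => 'D_X f G) F.
Proof.
move=> oU UF df d2f f0 fge0 k0 kf; set D2 := 'D_X _ F.
have UFd : \forall s \near (0 : R), U (F + s *: X).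
  have cF : (fun s : R => F + s *: X) s @[s --> (0 : R)] --> F + 0 *: X.
    by apply: cvgD; [exact: cvg_cst|apply: cvgZr_tmp; exact: cvg_id].
  by apply: cF; apply: open_nbhs_nbhs; rewrite scale0r addr0.
have [d0 d0_gt0 Ud0] : exists2 d : R, 0 < d & forall s : R, `|s| < d -> U (F + s *: X).
  case/nbhs_ballP : UFd => d /= d0 hd; exists d => // s sd; apply: hd.
  by rewrite /ball/= sub0r normrN.
have D1 : 'D_X f F = 0.
  have dl (s : R) : `|s| < d0 ->
      is_derive s (1 : R) (fun r : R => f (F + r *: X)) ('D_X f (F + s *: X)).
    by move=> sd; apply/is_derive_line/df/Ud0.
  have := @derive1_at_min R (fun r : R => f (F + r *: X)) (- d0) d0 0.
  rewrite ge0_cp ?ltW//.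
  have h1 : forall t, t \in `]- d0, d0[ -> derivable (fun r : R => f (F + r *: X)) t 1.
    by move=> t; rewrite in_itv/= -ltr_norml => /dl [].
  move=> /(_ isT h1); rewrite in_itv/= oppr_lt0 d0_gt0 => /(_ isT).
  rewrite scale0r addr0 f0 => /(_ (fun t _ => fge0 _)) [_].
  have [_] := dl 0 ltac:(by rewrite normr0).
  by rewrite scale0r addr0 => ->.
pose q (h : R) := h^-1 *: (((fun G => 'D_X f G) \o shift F) (h *: X) - 'D_X f F).
have qc : q h @[h --> 0^'] --> D2 by exact: d2f.
apply/ler_addgt0Pr => e e0.
have : \forall h \near 0^', `|D2 - q h| < e /\ k * h ^+ 2 <= f (F + h *: X).
  near=> h; split; near: h => //.
  by move/cvgrPdist_lt : qc => /(_ e e0).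
rewrite /dnbhs /within/= => /nbhs_ballP[d /= d_gt0 hd].
pose m := Num.min d d0 / 2.
have m0 : 0 < m by rewrite divr_gt0// lt_min d_gt0.
have [md md0] : m < d /\ m < d0.
  have : m < Num.min d d0 by rewrite /m ltr_pdivrMr// ltr_pMr ?ltr1n// lt_min d_gt0.
  by rewrite lt_min => /andP.
have hm s : 0 < s -> s < d -> `|D2 - q s| < e /\ k * s ^+ 2 <= f (F + s *: X).
  move=> s0 sd; apply: hd; last by rewrite gt_eqF.
  by rewrite /ball/= sub0r normrN gtr0_norm.
have dfs (s : R) : `|s| <= `|m| -> derivable f (F + s *: X) X.
  by move=> sm; apply/df/Ud0/(le_lt_trans sm); rewrite gtr0_norm.
have [s /andP[sm sm0] E] := line_MVT dfs.
rewrite f0 subr0 in E.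
have [_] := hm m m0 md; rewrite E expr2 mulrCA ler_pM2l// => km.
move: sm sm0; rewrite (gt_eqF m0)/= pmulr_lgt0// => sm sm0.
rewrite !gtr0_norm// in sm.
have [] := hm s sm0 (le_lt_trans sm md).
rewrite /q/= D1 subr0 [s *: X + F]addrC [_ *: _]mulrC => /ltW.
set g := 'D_X f _ in km *; rewrite ler_norml => /andP[h1 _] _.
have gs : g <= s * (D2 + e).
  have : g / s <= D2 + e by lra.
  by rewrite ler_pdivrMr// mulrC.
have {gs}kms : k * m <= s * (D2 + e) by rewrite (le_trans km).
have D2e : 0 <= D2 + e by rewrite -(pmulr_rge0 _ sm0) (le_trans _ kms)// mulr_ge0// ltW.
rewrite -(ler_pM2r m0) (le_trans kms)// mulrC ler_wpM2l//.
Unshelve. all: by end_near. Qed.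

End DirectionalDerivatives.

(** * The second derivative of the energy density at the identity *)

Section EnergyDensity.
Context {R : realType}.
Implicit Types (F G : 'M[R]_3).

Lemma frob_ge0 m n (M : 'M[R]_(m, n)) : 0 <= frob M.
Proof. exact: sqrtr_ge0. Qed.

Lemma frob_sqr m n (M : 'M[R]_(m, n)) : frob M ^+ 2 = mxdot M M.
Proof. by rewrite sqr_sqrtr// mxdot_ge0. Qed.

Lemma le_entry_frob m n (M : 'M[R]_(m, n)) i j : `|M i j| <= frob M.
Proof.
rewrite -(ler_pXn2r (n := 2))// ?nnegrE ?frob_ge0// frob_sqr mxdotE.
rewrite (bigD1 i)//= (bigD1 j)//= -addrA real_normK ?num_real// expr2 lerDl.
by apply: addr_ge0; do ?apply: sumr_ge0 => ? _; rewrite -?expr2 ?sqr_ge0//;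
  apply: sumr_ge0 => ? _; rewrite -expr2 sqr_ge0.
Qed.

Lemma SO3_1 : SO3 (1%:M : 'M[R]_3).
Proof. by split; rewrite ?trmx1 ?mulmx1 ?det1. Qed.

(** For Q in SO(3) the matrix D = 1 - Q satisfies D + D^T = D^T D; with
E = 1 + h G - Q this reads 2 h sym G = E + E^T - D^T D, so that E cannot be
much smaller than h sym G, the last term being of order h^2. *)
Lemma distSO3_lower_bound G : sympart G != 0 ->
  exists2 k : R, 0 < k &
    \forall h \near (0 : R)^', k * `|h| <= distSO3 (1%:M + h *: G).
Proof.
move=> /matrix0Pn[i [j Sij]]; set s := `|sympart G i j|.
have s0 : 0 < s by rewrite normr_gt0.
pose k := s / 2; have k0 : 0 < k by rewrite divr_gt0.
pose K := k + frob G; have K0 : 0 < K by rewrite ltr_wpDr// frob_ge0.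
exists k => //; near=> h.
have hs : `|h| * (3 * K ^+ 2) < s.
  have : `|h| < s / (3 * K ^+ 2).
    by near: h; apply: dnbhs0_lt; rewrite divr_gt0// mulr_gt0// exprn_gt0.
  by rewrite ltr_pdivlMr// mulr_gt0// exprn_gt0.
have h0 : 0 < `|h| by rewrite normr_gt0; near: h; exact: nbhs_dnbhs_neq.
apply: lb_le_inf; first by exists (frob (1%:M + h *: G - 1%:M)), 1%:M => //; exact: SO3_1.
move=> _ [Q [QQ _] <-]; rewrite leNgt; apply/negP => Elt.
pose E := 1%:M + h *: G - Q; pose D : 'M[R]_3 := 1%:M - Q.
have DD : D + D^T = D^T *m D.
  rewrite /D linearB/= trmx1 mulmxBr mulmx1 mulmxBl mul1mx QQ opprB.
  by rewrite addrC.
have Eab a b : `|E a b| <= k * `|h| by rewrite (le_trans (le_entry_frob _ _ _))// ltW.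
have Dab a b : `|D a b| <= `|h| * K.
  have -> : D a b = E a b - h * G a b by rewrite !mxE; ring.
  rewrite (le_trans (ler_normB _ _))// /K mulrDr (mulrC _ k); apply: lerD => //.
  by rewrite normrM; apply: ler_wpM2l => //; exact: le_entry_frob.
have key : 2 * (h * sympart G i j) = E i j + E j i - (D^T *m D) i j.
  by rewrite -DD /D /E /sympart !mxE (eq_sym j); field.
have DDij : `|(D^T *m D) i j| <= 3 * (`|h| * K) ^+ 2.
  rewrite mxE (le_trans (ler_norm_sum _ _ _))//.
  rewrite (@le_trans _ _ (\sum_(l < 3) (`|h| * K) ^+ 2))//.
    by apply: ler_sum => l _; rewrite mxE normrM expr2 ler_pM.
  by rewrite sumr_const card_ord mulr_natl.
have : 2 * (`|h| * s) <= k * `|h| + k * `|h| + 3 * (`|h| * K) ^+ 2.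
  have -> : 2 * (`|h| * s) = `|2 * (h * sympart G i j)|.
    by rewrite normrM normrM ger0_norm.
  rewrite key (le_trans (ler_normB _ _))// lerD//.
  by rewrite (le_trans (ler_normD _ _))// lerD.
have -> : 2 * (`|h| * s) = `|h| * (2 * s) by ring.
have -> : k * `|h| + k * `|h| + 3 * (`|h| * K) ^+ 2 = `|h| * (s + `|h| * (3 * K ^+ 2)).
  by rewrite /k; field.
by rewrite ler_pM2l// leNgt => /negP; apply; lra.
Unshelve. all: by end_near. Qed.

(** The symmetric bilinear form that induces the quadratic form Q3. *)
Definition hess (W : R * R * R -> 'M[R]_3 -> R) x F G : R :=
  2^-1 * (D2W W x 1%:M F G + D2W W x 1%:M G F).

Lemma hess_Q3 W x F : hess W x F F = Q3 W x F.
Proof. by rewrite /hess /Q3; field. Qed.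

Section AtOnePoint.
Variables (W : R * R * R -> 'M[R]_3 -> R) (x : R * R * R) (U : set 'M[R]_3).
Hypotheses (oU : open U) (SU : SO3 `<=` U) (WC2 : C2_on W U x).

Lemma symform_hess : symform (hess W x).
Proof.
have U1 : U 1%:M by exact: SU SO3_1.
have dW Z G : U G -> derivable (W x) G Z by move=> /(WC2.2 Z)[].
have W1 a F G H : U H -> 'D_(a *: F + G) (W x) H = a * 'D_F (W x) H + 'D_G (W x) H.
  move=> UH; apply: (derive_linear a G oU UH dW).
  by have [_] := WC2.2 F H UH.
have dDW Z F G : U G -> derivable (fun F' => 'D_Z (W x) F') G F.
  by move=> /(WC2.2 Z) [_ _] /(_ F) [].
have W2r a F G H : D2W W x 1%:M H (a *: F + G) =
    a * D2W W x 1%:M H F + D2W W x 1%:M H G.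
  apply: (derive_linear a G oU U1 (dDW H)).
  by have [_ _ /(_ F) []] := WC2.2 H _ U1.
have W2l a F G H : D2W W x 1%:M (a *: F + G) H =
    a * D2W W x 1%:M F H + D2W W x 1%:M G H.
  rewrite /D2W.
  have -> : 'D_H (fun F' => 'D_(a *: F + G) (W x) F') 1%:M =
     'D_H (a *: (fun F' => 'D_F (W x) F') + (fun F' => 'D_G (W x) F')) 1%:M.
    apply: near_eq_derive; near=> F'; apply: W1; near: F'.
    exact: open_nbhs_nbhs.
  rewrite deriveD ?deriveZ//; [exact: dDW|exact: derivableZ (dDW _ _ _ U1)|exact: dDW].
exact: (symform_symmetrize W2l W2r).
Unshelve. all: by end_near. Qed.

Variables (c C : R).
Hypotheses (W_ge0 : forall F, 0 <= W x F) (W1 : W x 1%:M = 0) (c0 : 0 < c)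
  (W_dist : forall F, c * distSO3 F ^+ 2 <= W x F)
  (Q3_le : forall F, Q3 W x F <= C * frob (sympart F) ^+ 2).

Lemma hess_lower_bound F k : 0 <= k ->
  (\forall h \near 0^', k * h ^+ 2 <= W x (1%:M + h *: F)) ->
  k <= hess W x F F.
Proof.
move=> k0 hk; rewrite hess_Q3.
have U1 : U 1%:M by exact: SU SO3_1.
apply: (second_derive_lower_bound oU U1) => //.
  by move=> G /(WC2.2 F)[].
by have [_ _ /(_ F)[]] := WC2.2 F _ U1.
Qed.

(** The density grows at least like dist^2, that is like h^2 along 1 + h F. *)
Lemma hess_gt0 F : sympart F != 0 -> 0 < hess W x F F.
Proof.
move=> /distSO3_lower_bound[k k0 hk].
have ck0 : 0 < c * k ^+ 2 by rewrite mulr_gt0// exprn_gt0.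
apply: (lt_le_trans ck0); apply: hess_lower_bound; first exact: ltW.
near=> h.
have kh : k * `|h| <= distSO3 (1%:M + h *: F) by near: h.
apply: le_trans (W_dist _); rewrite -mulrA ler_wpM2l ?(ltW c0)//.
rewrite -[h ^+ 2]real_normK ?num_real// -exprMn.
by rewrite ler_pXn2r// nnegrE ?(le_trans _ kh)// mulr_ge0// (ltW k0).
Unshelve. all: by end_near. Qed.

Lemma hess_ge0 F : 0 <= hess W x F F.
Proof. by apply: hess_lower_bound => //; near=> h; rewrite mul0r.
Unshelve. all: by end_near. Qed.

(** The form vanishes on skew-symmetric matrices by the upper bound, and a
nonnegative form is invariant under its null vectors. *)
Lemma hess_sympart F : hess W x (sympart F) (sympart F) = hess W x F F.
Proof.
have skew : sympart (F - sympart F) = 0.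
  by apply/matrixP => i j; rewrite !mxE; field.
have FE : sympart F + (F - sympart F) = F by rewrite addrC subrK.
rewrite -[RHS](congr1 (fun G => hess W x G G) FE); symmetry.
apply: (form_add_kernel symform_hess); first exact: hess_ge0.
apply/eqP; rewrite eq_le hess_ge0 andbT hess_Q3 (le_trans (Q3_le _))//.
by rewrite skew frob_sqr (form0l (symform_mxdot _ _)) mulr0.
Qed.

End AtOnePoint.

End EnergyDensity.

(** * Integrals and minima depending on a parameter *)

Section NullSets.
Local Open Scope ereal_scope.
Context d (T : measurableType d) (R : realType)
  (mu : {measure set T -> \bar R}).
Import HBNNSimple.

(** The integral of a nonnegative function is the supremum of the integrals of
the simple functions below it, measurable or not; multiplying these by the
indicator of the complement of N does not change their integrals. *)
Lemma integral_setD_null (D N : set T) (f : T -> \bar R) :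
  measurable N -> mu N = 0 ->
  \int[mu]_(x in D) f x = \int[mu]_(x in D `\` N) f x.
Proof.
move=> mN N0.
have sup_null (g g' : T -> \bar R) : (forall x, 0 <= g x) ->
    (forall x, ~ N x -> g' x = g x) -> (forall x, N x -> g' x = 0) ->
    ereal_sup [set sintegral mu h | h in
      [set h : {nnsfun T >-> R} | forall x, (h x)%:E <= g x]] =
    ereal_sup [set sintegral mu h | h in
      [set h : {nnsfun T >-> R} | forall x, (h x)%:E <= g' x]].
  move=> g0 gC gN; apply/eqP; rewrite eq_le; apply/andP; split.
    apply: ge_ereal_sup => _ [h hg <-]; apply: ereal_sup_ubound.
    have projE x : proj_nnsfun h (measurableC mN) x = (h x * \1_(~` N) x)%R by [].
    exists (proj_nnsfun h (measurableC mN)) => [x|].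
      rewrite projE indicE; have [Nx|Nx] := pselect (N x).
        by rewrite memNset ?mulr0 ?gN//; apply.
      by rewrite mem_set// mulr1 gC.
    rewrite -!integralT_nnsfun.
    rewrite (ge0_negligible_integral mN)//; last 2 first.
      by apply/measurable_EFinP; exact: measurable_funP.
      by move=> x _; rewrite lee_fin; exact: fun_ge0.
    rewrite [RHS](ge0_negligible_integral mN)//; last 2 first.
      by apply/measurable_EFinP; exact: measurable_funP.
      by move=> x _; rewrite lee_fin; exact: fun_ge0.
    apply: eq_integral => x; rewrite inE => -[_ Nx].
    by rewrite projE indicE mem_set// mulr1.
  apply: ereal_sup_le => _ [h hg' <-]; exists h => // x.
  have [Nx|Nx] := pselect (N x); last by rewrite -gC.
  by rewrite (le_trans (hg' x))// gN.
have patchN (x : T) : ~ N x -> (f \_ (D `\` N)) x = (f \_ D) x.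
  by move=> Nx; rewrite !patchE in_setD (memNset Nx) andbT.
have patch0 (x : T) : N x -> (f \_ (D `\` N)) x = 0.
  by move=> Nx; rewrite !patchE in_setD (mem_set Nx) andbF.
rewrite /integral; congr (_ - _); apply: sup_null => // x Nx.
- by rewrite !funeposE patchN.
- by rewrite !funeposE patch0// maxxx.
- by rewrite !funenegE patchN.
- by rewrite !funenegE patch0// oppe0 maxxx.
Qed.

End NullSets.

Section Minima.
Context {R : realType}.

Lemma minimumE (S : set R) m : is_minimum S m -> minimum S = m.
Proof.
move=> [Sm lm]; rewrite /minimum.
have [Sm' lm'] : is_minimum S (xget 0 (is_minimum S)) by exact: xgetI (conj Sm lm).
by apply/eqP; rewrite eq_le lm//= lm'.
Qed.

(** The form b is left existential: only the value c at the vertex v0 and the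
shape of q matter for minima. *)
Definition completed_square {V : lmodType R} (q : V -> R) c v0 :=
  exists b : V -> V -> R, [/\ symform b, forall h, 0 <= b h h &
    forall v, q v = c + b (v - v0) (v - v0)].

Lemma completed_square_minimum (V : lmodType R) (q : V -> R) c v0 :
  completed_square q c v0 -> is_minimum [set q v | v in [set: V]] c.
Proof.
move=> [b [hb b0 qE]]; split => [|_ [v _ <-]]; last by rewrite qE lerDl.
by exists v0 => //; rewrite qE subrr (form0l hb) addr0.
Qed.

Lemma form_mx_bounded m n (b : 'M[R]_(m, n) -> 'M[R]_(m, n) -> R) : symform b ->
  exists2 K : R, 0 < K & forall (e : R) (h : 'M[R]_(m, n)), 0 <= e -> (forall i j, `|h i j| <= e) ->
    b h h <= K * e ^+ 2.
Proof.
move=> hb; pose D i j : 'M[R]_(m, n) := delta_mx i j.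
pose K := \sum_i \sum_j \sum_k \sum_l `|b (D i j) (D k l)|.
have K0 : 0 <= K by do 4!apply: sumr_ge0 => ? _.
exists (K + 1) => [|e h e0 he]; first by rewrite ltr_wpDl.
apply: (@le_trans _ _ (K * e ^+ 2)); last by rewrite ler_wpM2r ?sqr_ge0// lerDl.
rewrite {1}(matrix_sum_delta h) (form_suml hb) mulr_suml; apply: ler_sum => i _.
rewrite (form_suml hb) mulr_suml; apply: ler_sum => j _.
rewrite [X in b _ X](matrix_sum_delta h) (form_sumr hb) mulr_suml; apply: ler_sum => k _.
rewrite (form_sumr hb) mulr_suml; apply: ler_sum => l _.
rewrite (formZl hb) (formZr hb) (le_trans (ler_norm _))// !normrM mulrA mulrC.
by rewrite ler_wpM2l// expr2 ler_pM.
Qed.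

(** At distance e of the vertex the value is at most c + K e^2, so a rational
point close enough to the vertex does. *)
Lemma completed_square_rat m n (q : 'M[R]_(m, n) -> R) c v0 a :
  completed_square q c v0 -> c < a ->
  exists r : 'M[rat]_(m, n), q (map_mx ratr r) < a.
Proof.
move=> [b [hb b0 qE]] ca; have [K K0 hK] := form_mx_bounded hb.
(* As e <= 1, K e^2 <= K e <= (a - c) / 2. *)
pose e := Num.min 1 ((a - c) / (2 * K)).
have e0 : 0 < e by rewrite lt_min ltr01 divr_gt0 ?subr_gt0// mulr_gt0.
have ratP i j : exists r : rat, `|ratr r - v0 i j| <= e.
  have [|r] := @rat_in_itvoo R (v0 i j - e) (v0 i j + e).
    by rewrite ltrD2l (lt_trans _ e0)// oppr_lt0.
  rewrite in_itv/= => /andP[r1 r2]; exists r.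
  by rewrite ler_norml lerBlDr lerBrDl !ltW//= addrC.
pose r : 'M[rat]_(m, n) := \matrix_(i, j) projT1 (cid (ratP i j)).
exists r; rewrite qE -ltrBrDl (@le_lt_trans _ _ (K * e ^+ 2))//.
  apply: hK => [|i j]; first exact: ltW.
  by rewrite !mxE; exact: projT2 (cid (ratP i j)).
have : K * e ^+ 2 <= K * ((a - c) / (2 * K)).
  rewrite ler_pM2l// expr2 (@le_trans _ _ (1 * e))//.
    by rewrite ler_wpM2r ?(ltW e0)// ge_min lexx.
  by rewrite mul1r ge_min lexx orbT.
move/le_lt_trans; apply.
have -> : K * ((a - c) / (2 * K)) = (a - c) / 2 by field; rewrite gt_eqF.
lra.
Qed.

(** By the previous lemma the minimum lies below a exactly when one of countably
many rational points has a value below a. *)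
Lemma measurable_minimum d (T : measurableType d) (D : set T) m n
    (q : T -> 'M[R]_(m, n) -> R) (c : T -> R) :
  (forall s, measurable_fun D (q ^~ s)) ->
  (forall x, D x -> exists v0, completed_square (q x) (c x) v0) ->
  measurable_fun D c.
Proof.
move=> mq hq mD; apply: (measurability _ (RGenInftyO.measurableE R)) => //.
move=> /= _ [_ [a ->] <-].
rewrite [X in measurable X](_ : _ = \bigcup_(r : 'M[rat]_(m, n))
    (D `&` (q ^~ (map_mx ratr r)) @^-1` `]-oo, a[)); last first.
  apply/seteqP; split=> x /=; rewrite in_itv/=.
    move=> [Dx ca]; have [v0 sq] := hq x Dx.
    have [r qr] := completed_square_rat sq ca.
    by exists r => //; split => //=; rewrite in_itv.
  move=> [r _ [Dx /=]]; rewrite in_itv/= => qa; split => //.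
  have [v0 /completed_square_minimum[_ lb]] := hq x Dx.
  by apply: le_lt_trans qa; apply: lb; exists (map_mx ratr r).
apply: countable_bigcupT_measurable => // r.
by apply: mq => //; exact: measurable_itv.
Qed.

End Minima.

Section PlaneMeasurability.
Context {R : realType}.
Local Notation plane := (measurableTypeR R * measurableTypeR R)%type.

(** An open set is the union of the rational boxes contained in it. *)
Lemma open_measurable_plane (U : set (R * R)) : open U -> measurable (U : set plane).
Proof.
move=> oU.
pose box (i : rat * rat * (rat * rat)) : set (R * R) :=
  `]ratr i.1.1, ratr i.1.2[ `*` `]ratr i.2.1, ratr i.2.2[.
pose F i : set plane := if asbool (box i `<=` U) then box i else set0.
have -> : (U : set plane) = \bigcup_i F i.
  apply/seteqP; split=> [x Ux|x [i _]]; last first.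
    by rewrite /F; case: asboolP => // iU /iU.
  have : nbhs x U by exact: open_nbhs_nbhs.
  case/nbhs_ballP => e /= e0 xU.
  have ratP (y : R) : exists p : rat * rat, [/\ y - e < ratr p.1, (ratr p.1 : R) < y,
      y < ratr p.2 & (ratr p.2 : R) < y + e].
    have [|p] := @rat_in_itvoo R (y - e) y; first by rewrite ltrBlDr ltrDl.
    have [|r] := @rat_in_itvoo R y (y + e); first by rewrite ltrDl.
    by rewrite !in_itv/= => /andP[? ?] /andP[? ?]; exists (p, r).
  have [p [p1 p2 p3 p4]] := ratP x.1; have [r [r1 r2 r3 r4]] := ratP x.2.
  exists (p, r) => //; rewrite /F; case: asboolP => [_|].
    by split => /=; rewrite in_itv/= ?p2 ?p3 ?r2 ?r3.
  case=> -[z1 z2] [/=]; rewrite !in_itv/= => /andP[? ?] /andP[? ?]; apply: xU.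
  by split; rewrite -ball_normE/= ltr_norml; lra.
apply: countable_bigcupT_measurable => // i; rewrite /F.
case: asboolP => _; last exact: measurable0.
by apply: measurableX; exact: measurable_itv.
Qed.

Lemma continuous_measurable_plane (U : set (R * R)) (f : R * R -> R) : open U ->
  (forall x, U x -> {for x, continuous f}) -> measurable_fun (U : set plane) f.
Proof.
move=> oU cf mU; apply: (measurability _ (RGenOInfty.measurableE R)) => //.
move=> /= _ [_ [a ->] <-]; apply: open_measurable_plane.
rewrite openE => x [Ux /=]; rewrite in_itv/= andbT => ax.
have /cvgr_gt fgt : f z @[z --> x] --> f x by exact: cf.
have h : \forall z \near x, U z /\ a < f z.
  near=> z; split; near: z; first exact: open_nbhs_nbhs.
  exact: fgt.
by apply: filterS h => z [Uz fz]; split=> //=; rewrite in_itv/= andbT.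
Unshelve. all: by end_near. Qed.

End PlaneMeasurability.

(** * Measurability of matrices, derivatives and sections *)

(** The inverse is continuous on the complement of 0. *)
Lemma measurable_inv (R : realType) : measurable_fun setT (@GRing.inv R).
Proof.
rewrite -(setUv [set 0 : R]); apply/measurable_funU => //.
  exact: measurableC.
split; first exact: measurable_fun_set1.
apply: open_continuous_measurable_fun.
  by rewrite openC; exact: closed_eq.
by move=> x; rewrite inE => /eqP x0; exact: inv_continuous.
Qed.

Section MeasurableMatrices.
Context d (T : measurableType d) (R : realType) (D : set T).

Definition measurable_mx m n (M : T -> 'M[R]_(m, n)) :=
  forall i j, measurable_fun D (fun x => M x i j).

Lemma measurable_mx_cst m n (M : 'M[R]_(m, n)) : measurable_mx (fun=> M).
Proof. by move=> i j; exact: measurable_cst. Qed.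

Lemma measurable_mxD m n (M N : T -> 'M[R]_(m, n)) :
  measurable_mx M -> measurable_mx N -> measurable_mx (fun x => M x + N x).
Proof.
move=> mM mN i j; apply: eq_measurable_fun (measurable_funD (mM i j) (mN i j)).
by move=> x _; rewrite /= mxE.
Qed.

Lemma measurable_mxZ m n (f : T -> R) (M : T -> 'M[R]_(m, n)) :
  measurable_fun D f -> measurable_mx M -> measurable_mx (fun x => f x *: M x).
Proof.
move=> mf mM i j; apply: eq_measurable_fun (measurable_funM mf (mM i j)).
by move=> x _; rewrite /= mxE.
Qed.

Lemma measurable_mxB m n (M N : T -> 'M[R]_(m, n)) :
  measurable_mx M -> measurable_mx N -> measurable_mx (fun x => M x - N x).
Proof.
move=> mM mN i j; apply: eq_measurable_fun (measurable_funB (mM i j) (mN i j)).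
by move=> x _; rewrite /= !mxE.
Qed.

Lemma measurable_mxM m n p (M : T -> 'M[R]_(m, n)) (N : T -> 'M[R]_(n, p)) :
  measurable_mx M -> measurable_mx N -> measurable_mx (fun x => M x *m N x).
Proof.
move=> mM mN i k.
apply: (@eq_measurable_fun _ _ _ _ _ (fun x => \sum_j M x i j * N x j k)).
  by move=> x _; rewrite mxE.
by apply: measurable_sum => j; exact: measurable_funM.
Qed.

Lemma measurable_mx_tr m n (M : T -> 'M[R]_(m, n)) :
  measurable_mx M -> measurable_mx (fun x => (M x)^T).
Proof.
move=> mM i j; apply: eq_measurable_fun (mM j i).
by move=> x _; rewrite mxE.
Qed.

Lemma measurable_det n (M : T -> 'M[R]_n) : measurable_mx M ->
  measurable_fun D (fun x => \det (M x)).
Proof.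
move=> mM; apply: measurable_sum => s; apply: measurable_funM.
  exact: measurable_cst.
by apply: measurable_prod => i _; exact: mM.
Qed.

Lemma measurable_mx_inv n (M : T -> 'M[R]_n) :
  (forall x, D x -> M x \in unitmx) -> measurable_mx M ->
  measurable_mx (fun x => invmx (M x)).
Proof.
move=> Mu mM i j.
pose N x : 'M[R]_(n.-1) := row' j (col' i (M x)).
apply: (@eq_measurable_fun _ _ _ _ _
    (fun x => (\det (M x))^-1 * ((-1) ^+ (j + i) * \det (N x)))).
  by move=> x; rewrite inE => Dx; rewrite /invmx Mu// !mxE.
apply: measurable_funM; first exact: (measurableT_comp (@measurable_inv R) (measurable_det mM)).
apply: measurable_funM; first exact: measurable_cst.
apply: measurable_det => k l; apply: eq_measurable_fun (mM (lift j k) (lift i l)).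
by move=> x _; rewrite !mxE.
Qed.

Lemma measurable_form m n (b : T -> 'M[R]_(m, n) -> 'M[R]_(m, n) -> R) F G :
  (forall x, D x -> symform (b x)) ->
  (forall X Y, measurable_fun D (fun x => b x X Y)) ->
  measurable_mx F -> measurable_mx G ->
  measurable_fun D (fun x => b x (F x) (G x)).
Proof.
move=> hb mb mF mG.
apply: (@eq_measurable_fun _ _ _ _ _ (fun x => \sum_i \sum_j \sum_k \sum_l
   (F x i j * (G x k l * b x (delta_mx i j) (delta_mx k l))))).
  move=> x; rewrite inE => /hb bx.
  rewrite [X in _ = b x X _](matrix_sum_delta (F x)) (form_suml bx).
  apply: eq_bigr => i _; rewrite (form_suml bx); apply: eq_bigr => j _.
  rewrite (formZl bx) [X in _ = _ * b x _ X](matrix_sum_delta (G x)).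
  rewrite (form_sumr bx) mulr_sumr; apply: eq_bigr => k _.
  rewrite (form_sumr bx) mulr_sumr; apply: eq_bigr => l _.
  by rewrite (formZr bx).
do 4!apply: measurable_sum => ?.
by apply: measurable_funM; [exact: mF|apply: measurable_funM; [exact: mG|exact: mb]].
Qed.

(** The derivative is the limit of the difference quotients along a sequence
of steps that keep the points inside U. *)
Lemma measurable_derive (V : normedModType R) (f : T -> V -> R) F X (U : set V) :
  open U -> U F -> (forall G, U G -> measurable_fun D (f ^~ G)) ->
  (forall x, D x -> derivable (f x) F X) ->
  measurable_fun D (fun x => 'D_X (f x) F).
Proof.
move=> oU UF mf df.
have UFd : \forall s \near (0 : R), U (s *: X + F).
  have cF : (fun s : R => s *: X + F) s @[s --> (0 : R)] --> 0 *: X + F.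
    by apply: cvgD; [apply: cvgZr_tmp; exact: cvg_id|exact: cvg_cst].
  by apply: cF; apply: open_nbhs_nbhs; rewrite scale0r add0r.
case/nbhs_ballP : UFd => e /= e0 hU.
pose h n : R := e / 2 * harmonic n.
have h0 n : 0 < h n by rewrite mulr_gt0 ?divr_gt0// harmonic_gt0.
have hcv : h n @[n --> \oo] --> 0.
  by rewrite -[X in _ --> X](mulr0 (e / 2)); apply: cvgMl_tmp; exact: cvg_harmonic.
apply: (measurable_fun_cvg (h := fun n x => (h n)^-1 * (f x (h n *: X + F) - f x F))).
  move=> n; apply: measurable_funM; first exact: measurable_cst.
  apply: measurable_funB; apply: mf => //; apply: hU.
  rewrite /ball/= sub0r normrN gtr0_norm// (@le_lt_trans _ _ (e / 2))//.
    by rewrite /h /harmonic ler_piMr ?divr_ge0 ?(ltW e0)// invf_le1// ler1n.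
  by rewrite ltr_pdivrMr// ltr_pMr// ltr1n.
move=> x /df dx; apply/cvgrPdist_lt => r r0.
have /cvgrPdist_lt/(_ r r0) : (fun s : R => s^-1 *: ((f x \o shift F) (s *: X) - f x F)) s
    @[s --> 0^'] --> 'D_X (f x) F by exact: dx.
rewrite /dnbhs /within/= => /nbhs_ballP[a /= a0 ha].
have /cvgrPdist_lt/(_ a a0) : h n @[n --> \oo] --> 0 by exact: hcv.
by apply: filterS => n hn; apply: ha => //; rewrite gt_eqF.
Qed.

End MeasurableMatrices.

Section Sections.
Context {R : realType}.
Local Notation line := (measurableTypeR R).
Local Notation plane := (line * line)%type.
Local Notation space := (plane * line)%type.

Lemma null_xsections (N : set space) : measurable N -> leb3 N = 0%E ->
  {ae leb2, forall x : plane, leb1 (xsection N x) = 0%E}.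
Proof.
move=> mN N0.
have mf : measurable_fun setT (fun x : plane => leb1 (xsection N x)).
  exact: measurable_fun_xsection.
have /(ae_eq_integral_abs leb2 measurableT mf) :
    (\int[leb2]_(x in setT) `|leb1 (xsection N x)| = 0)%E.
  rewrite -N0; apply: eq_integral => x _; rewrite gee0_abs//.
by apply: filterS => x /(_ I).
Qed.

Lemma measurable_integral_xsection (G : set space) (F : space -> R) :
  measurable G -> measurable_fun G F -> (forall z, G z -> 0 <= F z) ->
  measurable_fun setT
    (fun x : plane => (\int[leb1]_(t in xsection G x) (F (x, t))%:E)%E).
Proof.
move=> mG mF F0.
pose f : space -> \bar R := (EFin \o F) \_ G.
have mf : measurable_fun setT f.
  by apply/(measurable_restrictT _ mG)/measurable_EFinP.
have f0 z : (0 <= f z)%E.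
  by rewrite /f patchE; case: ifPn => //; rewrite inE => Gz; rewrite lee_fin F0.
have := measurable_fun_fubini_tonelli_F (m2 := @lebesgue_measure R) f mf f0.
apply: eq_measurable_fun => x _.
rewrite /fubini_F [RHS]integral_mkcond; apply: eq_integral => t _.
by rewrite /f !patchE mem_xsection.
Qed.

End Sections.

(** * Integration across the thickness *)

Section Thickness.
Context {R : realType}.
Local Notation line := (measurableTypeR R).

(** D stands for the thickness minus a null set off which the data are well
behaved; integrals over the thickness only see D. *)
Variable D : set line.
Hypotheses (mD : measurable D) (DT : D `<=` thickness)
  (D0 : leb1 (thickness `\` D) = 0%E).

Lemma measurable_thickness : measurable (thickness : set line).
Proof. exact: measurable_itv. Qed.

Lemma leb1_thickness : leb1 (thickness : set line) = 1%E.
Proof.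
rewrite /leb1/= /thickness lebesgue_measure_itv/= lte_fin ifT.
  by rewrite -EFinD; congr (_%:E); lra.
by rewrite (@lt_trans _ _ 0)// ?oppr_lt0.
Qed.

Lemma leb1_D : leb1 D = 1%E.
Proof.
rewrite -leb1_thickness -(setDUK DT) measureU//; last 2 first.
- by apply: measurableD => //; exact: measurable_thickness.
- by rewrite setDIK.
by rewrite [X in (_ + X)%E](_ : _ = 0%E) ?adde0.
Qed.

Lemma integral_thickness f :
  \int[leb1]_(t in thickness) f t = \int[leb1]_(t in D) f t.
Proof.
have mN : measurable (thickness `\` D : set line).
  by apply: measurableD => //; exact: measurable_thickness.
by rewrite /Rintegral (@integral_setD_null _ line R leb1 thickness _ (EFin \o f) mN D0) setDD (setIidr DT).
Qed.

Definition bounded_measurable (f : R -> R) :=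
  measurable_fun D f /\ exists M, forall t, D t -> `|f t| <= M.

Lemma bm_cst a : bounded_measurable (fun=> a).
Proof. by split; [exact: measurable_cst|exists `|a|]. Qed.

Lemma bmD f g : bounded_measurable f -> bounded_measurable g ->
  bounded_measurable (fun t => f t + g t).
Proof.
move=> [mf [M hM]] [mg [N hN]]; split; first exact: measurable_funD.
by exists (M + N) => t Dt; rewrite (le_trans (ler_normD _ _))// lerD ?hM ?hN.
Qed.

Lemma bmM f g : bounded_measurable f -> bounded_measurable g ->
  bounded_measurable (fun t => f t * g t).
Proof.
move=> [mf [M hM]] [mg [N hN]]; split; first exact: measurable_funM.
by exists (M * N) => t Dt; rewrite normrM ler_pM ?hM ?hN.
Qed.

Lemma bm_sum I (r : seq I) (f : I -> R -> R) :
  (forall i, bounded_measurable (f i)) ->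
  bounded_measurable (fun t => \sum_(i <- r) f i t).
Proof.
move=> bf; elim: r => [|i r IH].
  by under eq_fun do rewrite big_nil; exact: bm_cst.
by under eq_fun do rewrite big_cons; exact: bmD.
Qed.

Lemma bm_id : bounded_measurable id.
Proof.
split; first exact: measurable_id.
exists 2^-1 => t /DT; rewrite /thickness/= in_itv/= ler_norml => /andP[? ?].
by rewrite !ltW.
Qed.

Lemma bm_eq f g : (forall t, D t -> f t = g t) -> bounded_measurable f ->
  bounded_measurable g.
Proof.
move=> fg [mf [M hM]]; split; last by exists M => t Dt; rewrite -fg ?hM.
by apply: eq_measurable_fun mf => t; rewrite inE => /fg.
Qed.

Lemma bm_integrable f : bounded_measurable f -> leb1.-integrable D (EFin \o f).
Proof.
move=> [mf [M hM]]; apply: measurable_bounded_integrable => //.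
  by rewrite leb1_D ltry.
exists M; split; first exact: num_real.
by move=> N MN t Dt; exact: le_trans (hM t Dt) (ltW MN).
Qed.

Local Notation I f := (\int[leb1]_(t in thickness) f t).

Lemma eq_integral_thickness f g : (forall t, D t -> f t = g t) ->
  I f = I g.
Proof.
move=> fg; rewrite !integral_thickness; apply: eq_Rintegral => t.
by rewrite inE => /fg.
Qed.

Lemma integral_thicknessD f g : bounded_measurable f -> bounded_measurable g ->
  I (fun t => f t + g t) = I f + I g.
Proof. by move=> bf bg; rewrite !integral_thickness RintegralD//; exact: bm_integrable. Qed.

Lemma integral_thicknessZ a f : bounded_measurable f ->
  I (fun t => a * f t) = a * I f.
Proof. by move=> bf; rewrite !integral_thickness RintegralZl//; exact: bm_integrable. Qed.

Lemma integral_thickness0 : I (fun=> 0) = 0 :> R.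
Proof. by rewrite /Rintegral integral0_eq. Qed.

Lemma integral_thickness_sum J (r : seq J) (f : J -> R -> R) :
  (forall i, bounded_measurable (f i)) ->
  I (fun t => \sum_(i <- r) f i t) = \sum_(i <- r) I (f i).
Proof.
move=> bf; elim: r => [|i r IH].
  rewrite big_nil; under eq_Rintegral do rewrite big_nil.
  exact: integral_thickness0.
rewrite big_cons -IH -integral_thicknessD//; last exact: bm_sum.
by under eq_Rintegral do rewrite big_cons.
Qed.

Lemma integral_thickness_ge0 f : (forall t, D t -> 0 <= f t) -> 0 <= I f.
Proof. by move=> f0; rewrite integral_thickness; exact: Rintegral_ge0. Qed.

(** A null integral would force f to vanish almost everywhere on D, which has
measure 1. *)
Lemma integral_thickness_gt0 f (t0 : R) : bounded_measurable f ->
  (forall t, D t -> t != t0 -> 0 < f t) -> (D t0 -> 0 <= f t0) -> 0 < I f.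
Proof.
move=> bf fpos ft0.
have f0 t : D t -> 0 <= f t.
  move=> Dt; have [tE|/(fpos t Dt)/ltW//] := eqVneq t t0.
  by rewrite tE; apply: ft0; rewrite -tE.
rewrite lt_neqAle integral_thickness_ge0// andbT eq_sym; apply/negP => /eqP If0.
have intf := bm_integrable bf.
have mf : measurable_fun D (EFin \o f) by exact: measurable_int intf.
have : (\int[leb1]_(t in D) `|(EFin \o f) t| = 0)%E.
  rewrite -[RHS]/(0%:E) -If0 integral_thickness /Rintegral fineK; last first.
    exact: integrable_fin_num.
  by apply: eq_integral => t; rewrite inE => Dt; rewrite gee0_abs// lee_fin f0.
move=> /(ae_eq_integral_abs leb1 mD mf) fae.
have : leb1.-negligible D.
  apply: negligibleS (negligibleU fae (_ : leb1.-negligible [set t0])).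
    move=> t Dt; have [->|tt0] := eqVneq t t0; [by right|left => /(_ Dt)/= /eqP].
    by rewrite eqe => /eqP ft; have := fpos t Dt tt0; rewrite ft ltxx.
  by apply/negligibleP => //; exact: lebesgue_measure_set1.
move=> /(negligibleP _ mD) LD0.
by have /eqP := etrans (esym LD0) leb1_D; rewrite eq_sym onee_eq0.
Qed.

End Thickness.

(** * Projection onto affine functions of the thickness variable *)

Section Fiber.
Context {R : realType}.
Local Notation line := (measurableTypeR R).
Variable D : set line.
Hypotheses (mD : measurable D) (DT : D `<=` thickness)
  (D0 : leb1 (thickness `\` D) = 0%E).
Local Notation I f := (\int[leb1]_(t in thickness) f t).
Local Notation bm := (bounded_measurable D).

Definition bm_sym2 (f : R -> sym2 R) := forall Y, bm (fun t => dot2 (f t) Y).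

Lemma bm_sym2_cst X : bm_sym2 (fun=> X).
Proof. by move=> Y; exact: bm_cst. Qed.

Lemma bm_sym2D f g : bm_sym2 f -> bm_sym2 g -> bm_sym2 (fun t => f t + g t).
Proof.
move=> bf bg Y; apply: bm_eq (bmD (bf Y) (bg Y)) => t _.
by rewrite (formDl symform_dot2).
Qed.

Lemma bm_sym2Z a f : bm a -> bm_sym2 f -> bm_sym2 (fun t => a t *: f t).
Proof.
move=> ba bf Y; apply: bm_eq (bmM ba (bf Y)) => t _.
by rewrite (formZl symform_dot2).
Qed.

Lemma bm_dot2 f g : bm_sym2 f -> bm_sym2 g -> bm (fun t => dot2 (f t) (g t)).
Proof.
move=> bf bg.
apply: bm_eq (_ : bm (fun t => \sum_i \sum_j
    dot2 (f t) (sdelta i j) * dot2 (g t) (sdelta i j))).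
  move=> t _; rewrite [RHS]/dot2 mxdotE.
  by do 2!apply: eq_bigr => ? _; rewrite !dot2_sdelta.
by do 2!apply: bm_sum => ?; exact: bmM.
Qed.

Lemma dot2_int_sym2 f Y : bm_sym2 f ->
  dot2 (int_sym2 f) Y = I (fun t => dot2 (f t) Y).
Proof.
move=> bf; rewrite dot2_to_sym2 mxdotE.
under [RHS]eq_Rintegral => t _ do rewrite /dot2 mxdotE.
have bfY i j : bm (fun t => vsval (f t) i j * vsval Y i j).
  apply: bm_eq (bmM (bf (sdelta i j)) (bm_cst D (vsval Y i j))) => t _.
  by rewrite dot2_sdelta.
rewrite (integral_thickness_sum mD DT D0); last by move=> i; exact: bm_sum.
apply: eq_bigr => i _; rewrite (integral_thickness_sum mD DT D0)//.
apply: eq_bigr => j _; rewrite mxE mulrC -(integral_thicknessZ mD DT D0).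
  by apply: eq_Rintegral => t _; rewrite mulrC.
by apply: bm_eq (bf (sdelta i j)) => t _; rewrite dot2_sdelta.
Qed.

Lemma dot2_int_End (M : R -> 'End(sym2 R)) X Y :
  (forall Z, bm_sym2 (fun t => M t Z)) ->
  dot2 (int_End M X) Y = I (fun t => dot2 (M t X) Y).
Proof.
move=> bM; rewrite /int_End linfun_linearE ?dot2_int_sym2// => a u v.
apply: dot2_inj => Z; rewrite [RHS]symform_dot2.2 !dot2_int_sym2//.
rewrite -[X in _ = X + _](integral_thicknessZ mD DT D0 a (bM u Z)).
rewrite -(integral_thicknessD mD DT D0 (bmM (bm_cst D a) (bM u Z)) (bM v Z)).
by apply: eq_Rintegral => t _; rewrite linearP symform_dot2.2.
Qed.

Variables (W : R * R * R -> 'M[R]_3 -> R) (A : R * R -> 'M[R]_3)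
  (B : R * R * R -> 'M[R]_3) (x : R * R).
Local Notation L := (L2 W A x).
Local Notation Px := (P A B x).
Hypotheses (Lsa : forall t, D t -> selfadjoint (L t))
  (Lpos : forall t, D t -> forall X, X != 0 -> 0 < dot2 (L t X) X)
  (Lbm : forall X, bm_sym2 (fun t => L t X)) (Pbm : bm_sym2 Px).

Lemma bm_L2 f : bm_sym2 f -> bm_sym2 (fun t => L t (f t)).
Proof.
move=> bf Y; apply: bm_eq (bm_dot2 bf (Lbm Y)) => t Dt.
by rewrite (Lsa Dt).
Qed.

Lemma bm_dotL2 f g : bm_sym2 f -> bm_sym2 g ->
  bm (fun t => dot2 (L t (f t)) (g t)).
Proof. by move=> bf bg; apply: bm_dot2 => //; exact: bm_L2. Qed.

(** Integrability restricts the inner product to part of the functions of t.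
All those at hand are combinations c P + S + t S' with constant c, S, S'; on the
space of the triples (c, S, S') the inner product is an everywhere defined
bilinear form. *)
Local Notation triple := (R^o * sym2 R * sym2 R)%type.

Lemma triple_eq (u v : triple) :
  u.1.1 = v.1.1 -> u.1.2 = v.1.2 -> u.2 = v.2 -> u = v.
Proof. by case: u v => [[? ?] ?] [[? ?] ?] /= -> -> ->. Qed.

Definition comb (u : triple) : R -> sym2 R :=
  fun t => u.1.1 *: Px t + u.1.2 + t *: u.2.

Definition qf (u v : triple) : R := dotL2 W A x (comb u) (comb v).

Lemma bm_comb u : bm_sym2 (comb u).
Proof.
apply: bm_sym2D; first apply: bm_sym2D.
- by apply: bm_sym2Z => //; exact: bm_cst.
- exact: bm_sym2_cst.
- by apply: bm_sym2Z; [exact: bm_id|exact: bm_sym2_cst].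
Qed.

Lemma combP a u v t : comb (a *: u + v) t = a *: comb u t + comb v t.
Proof.
rewrite /comb/= !scalerDr !scalerDl !scalerA (mulrC t a).
by rewrite [X in X + _ = _]addrACA [LHS]addrACA.
Qed.

Lemma symform_qf : symform qf.
Proof.
split=> [u v|a u v w].
  apply: (eq_integral_thickness mD DT D0) => t Dt.
  by rewrite (Lsa Dt) (formC symform_dot2).
have buw y : bm (fun t => dot2 (L t (comb y t)) (comb w t)).
  by apply: bm_dotL2; exact: bm_comb.
rewrite /qf /dotL2 -[X in _ = X + _](integral_thicknessZ mD DT D0 a (buw u)).
rewrite -(integral_thicknessD mD DT D0 (bmM (bm_cst D a) (buw u)) (buw v)).
by apply: eq_Rintegral => t _; rewrite combP linearP symform_dot2.2.
Qed.

Lemma L2_ge0 t X : D t -> 0 <= dot2 (L t X) X.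
Proof.
move=> Dt; have [->|X0] := eqVneq X 0; last exact/ltW/Lpos.
by rewrite (form0r symform_dot2).
Qed.

Lemma qf_ge0 u : 0 <= qf u u.
Proof.
by apply: (integral_thickness_ge0 mD DT D0) => t Dt; exact: L2_ge0.
Qed.

(** An affine function of t other than zero vanishes at most once. *)
Lemma qf_affine_gt0 S0 S1 : (S0, S1) != 0 -> 0 < qf (0, S0, S1) (0, S0, S1).
Proof.
move=> S01.
have cE t : comb (0, S0, S1) t = S0 + t *: S1 by rewrite /comb/= scale0r add0r.
have [t0 ht0] : exists t0, forall t, t != t0 -> S0 + t *: S1 != 0.
  have [[t0 t0E]|nex] := pselect (exists t, S0 + t *: S1 = 0); last first.
    by exists 0 => t _; apply/eqP => St; apply: nex; exists t.
  exists t0 => t tt0; apply: contra S01 => /eqP tE.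
  have : (t - t0) *: S1 = 0.
    by rewrite scalerBl -[RHS](subrr (0 : sym2 R)) -{1}tE -t0E opprD addrACA subrr add0r.
  move/eqP; rewrite scaler_eq0 subr_eq0 (negPf tt0)/= => /eqP S10.
  by move: tE; rewrite S10 scaler0 addr0 => ->.
apply: (integral_thickness_gt0 mD DT D0 (t0 := t0)).
- by apply: bm_dotL2; exact: bm_comb.
- by move=> t Dt tt0; apply: Lpos; rewrite // cE ht0.
- by move=> Dt; exact: L2_ge0.
Qed.

Local Notation cst_ X := ((0, X, 0) : triple).
Local Notation lin_ X := ((0, 0, X) : triple).

Lemma cst_qf_gt0 X : X != 0 -> 0 < qf (cst_ X) (cst_ X).
Proof. by move=> X0; apply: qf_affine_gt0; rewrite xpair_eqE (negPf X0). Qed.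

Lemma comb_cst X : comb (cst_ X) = fun=> X.
Proof. by apply/funext => t; rewrite /comb/= scale0r add0r scaler0 addr0. Qed.

Lemma comb_lin X : comb (lin_ X) = fun t => t *: X.
Proof. by apply/funext => t; rewrite /comb/= scale0r add0r add0r. Qed.

Lemma comb_P : comb (1, 0, 0) = Px.
Proof. by apply/funext => t; rewrite /comb/= scale1r scaler0 !addr0. Qed.

Lemma dot2_L2star X Y : dot2 (L2star W A x X) Y = qf (cst_ X) (cst_ Y).
Proof. by rewrite dot2_int_End// /qf !comb_cst. Qed.

Lemma L2star_gt0 X : X != 0 -> 0 < dot2 (L2star W A x X) X.
Proof. by move=> X0; rewrite dot2_L2star cst_qf_gt0. Qed.

Lemma L2star_posdef : posdef (L2star W A x).
Proof.
split=> [X Y|]; last exact: L2star_gt0.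
by rewrite (formC symform_dot2 X) !dot2_L2star (formC symform_qf).
Qed.

(** That is, phi projects orthogonally onto the constants. *)
Lemma phi_comb u Y : qf (cst_ (phi W A x (comb u))) (cst_ Y) = qf u (cst_ Y).
Proof.
rewrite -dot2_L2star /phi (posdef_invK L2star_gt0) dot2_int_sym2.
  by rewrite /qf comb_cst.
by apply: bm_L2; exact: bm_comb.
Qed.

Lemma cst_linear a X Y : cst_ (a *: X + Y) = a *: cst_ X + cst_ Y.
Proof. by apply: triple_eq; rewrite /= ?scaler0 ?addr0. Qed.

Lemma lin_linear a X Y : lin_ (a *: X + Y) = a *: lin_ X + lin_ Y.
Proof. by apply: triple_eq; rewrite /= ?scaler0 ?addr0. Qed.

Lemma phi_comb_linear a u v : phi W A x (comb (a *: u + v)) =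
  a *: phi W A x (comb u) + phi W A x (comb v).
Proof.
apply/eqP; rewrite -subr_eq0; apply: contraT => /cst_qf_gt0.
set X := _ - _.
rewrite [Y in qf Y _](_ : _ = cst_ (phi W A x (comb (a *: u + v))) -
    (a *: cst_ (phi W A x (comb u)) + cst_ (phi W A x (comb v)))); last first.
  by rewrite -cst_linear; apply: triple_eq; rewrite /= ?subrr.
rewrite (formBl symform_qf) symform_qf.2 !phi_comb symform_qf.2 subrr ltxx//.
Qed.

Lemma phi1E X : phi1 W A x X = phi W A x (comb (lin_ X)).
Proof.
rewrite /phi1 linfun_linearE ?comb_lin// => a u v.
by rewrite -!comb_lin lin_linear phi_comb_linear.
Qed.

(** The triple of the function t |-> V2 t X, orthogonal to the constants. *)
Definition vee X : triple := (0, - phi1 W A x X, X).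

Lemma veeE X : vee X = lin_ X - cst_ (phi1 W A x X).
Proof. by apply: triple_eq; rewrite /= ?subr0 ?sub0r ?oppr0. Qed.

Lemma V2E t X : V2 W A x t X = comb (vee X) t.
Proof.
rewrite /V2 /comb/= scale0r add0r add_lfunE opp_lfunE scale_lfunE id_lfunE.
by rewrite addrC.
Qed.

Lemma vee_cst X Y : qf (vee X) (cst_ Y) = 0.
Proof. by rewrite veeE (formBl symform_qf) phi1E phi_comb subrr. Qed.

(** The triple of the function N1, orthogonal to the constants. *)
Definition enn : triple := (1, - phi W A x Px, 0).

Lemma ennE : enn = (1, 0, 0) - cst_ (phi W A x Px).
Proof. by apply: triple_eq; rewrite /= ?subr0 ?sub0r ?oppr0. Qed.

Lemma N1E : N1 W A B x = comb enn.
Proof. by apply/funext => t; rewrite /N1 /comb/= scale1r scaler0 addr0. Qed.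

Lemma enn_cst Y : qf enn (cst_ Y) = 0.
Proof. by rewrite ennE (formBl symform_qf) -comb_P phi_comb subrr. Qed.

Lemma bm_adjoint_V2 f : bm_sym2 f ->
  bm_sym2 (fun t => adjoint (V2 W A x t) (f t)).
Proof.
move=> bf Y; apply: bm_eq (bm_dot2 bf (bm_comb (vee Y))) => t _.
by rewrite adjointE V2E.
Qed.

Lemma bm_T2 Z : bm_sym2 (fun t => T2 W A x t Z).
Proof.
move=> S; apply: bm_eq (bm_adjoint_V2 (bm_L2 (bm_comb (vee Z))) S) => t _.
by rewrite !comp_lfunE V2E.
Qed.

Lemma dot2_T2star X Y : dot2 (T2star W A x X) Y = qf (vee X) (vee Y).
Proof.
rewrite (dot2_int_End _ _ bm_T2).
by apply: eq_Rintegral => t _; rewrite !comp_lfunE adjointE !V2E.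
Qed.

Lemma vee_gt0 X : X != 0 -> 0 < qf (vee X) (vee X).
Proof. by move=> X0; apply: qf_affine_gt0; rewrite xpair_eqE (negPf X0) andbF. Qed.

Theorem T2star_posdef : posdef (T2star W A x).
Proof.
split=> [X Y|X X0]; last by rewrite dot2_T2star vee_gt0.
by rewrite (formC symform_dot2 X) !dot2_T2star (formC symform_qf).
Qed.

Local Notation nst := (nstar W A B x).

(** That is, V2 n* is the projection of N1 onto the functions V2 Y. *)
Lemma nstarE Y : qf (vee nst) (vee Y) = qf enn (vee Y).
Proof.
rewrite -dot2_T2star /nstar (posdef_invK T2star_posdef.2) dot2_int_sym2.
  by apply: eq_Rintegral => t _; rewrite adjointE V2E N1E.
by apply: bm_adjoint_V2; apply: bm_L2; rewrite N1E; exact: bm_comb.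
Qed.

(** P minus its projection onto the affine functions. *)
Definition residual : triple := enn - vee nst.

(** An affine function S0 + t S1 is V2 S1 plus a constant. *)
Lemma residual_affine S0 S1 : qf residual (0, S0, S1) = 0.
Proof.
have -> : (0, S0, S1) = vee S1 + cst_ (S0 + phi1 W A x S1) :> triple.
  by apply: triple_eq; rewrite /= ?addr0// addrCA addNr addr0.
rewrite (formDr symform_qf) !(formBl symform_qf) nstarE subrr.
by rewrite enn_cst vee_cst subrr addr0.
Qed.

Lemma RemE : Rem W A B x = qf residual residual.
Proof.
have -> : Rem W A B x = qf enn enn - qf (vee nst) (vee nst).
  by rewrite /Rem N1E -dot2_T2star (dot2_int_End _ _ bm_T2).
by rewrite /residual (form_residual symform_qf (nstarE _)).
Qed.

Lemma Rem_ge0 : 0 <= Rem W A B x.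
Proof. by rewrite RemE qf_ge0. Qed.

(** The constant coefficient of the projection of P onto affine functions. *)
Definition aff0 : sym2 R := phi W A x Px - phi1 W A x nst.

Lemma comb_P_affine S0 S1 : Px \- affine S0 S1 = comb (1, - S0, - S1).
Proof.
apply/funext => t; rewrite /comb /affine/= scale1r scalerN opprD addrA//.
Qed.

Lemma residualE : residual = (1, - aff0, - nst).
Proof. by apply: triple_eq; rewrite /= ?subr0 ?sub0r// opprB opprK addrC. Qed.

Lemma qf_residualD S0 S1 :
  qf (residual + (0, S0, S1)) (residual + (0, S0, S1)) =
  Rem W A B x + qf (0, S0, S1) (0, S0, S1).
Proof. by rewrite (form_pythagoras symform_qf (residual_affine _ _)) RemE. Qed.

(** The affine function with coefficients aff0 and n* is the orthogonal
projection of P, as its difference from P is the residual. *)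
Theorem Rem_affine_projection :
  (exists2 p : R -> sym2 R, affine_proj W A x Px p &
     Rem W A B x = dotL2 W A x (Px \- p) (Px \- p)) /\
  is_minimum
    [set dotL2 W A x (Px \- affine S.1 S.2) (Px \- affine S.1 S.2)
    | S in [set: sym2 R * sym2 R]] (Rem W A B x).
Proof.
have Pp : Px \- affine aff0 nst = comb residual.
  by rewrite comb_P_affine residualE.
have RemP : Rem W A B x = dotL2 W A x (Px \- affine aff0 nst) (Px \- affine aff0 nst).
  by rewrite Pp RemE.
split; last split.
- exists (affine aff0 nst) => //; split=> [|S0 S1]; first by exists aff0, nst.
  rewrite Pp -[RHS](residual_affine S0 S1); congr (dotL2 _ _ _ _ _).
  by apply/funext => t; rewrite /comb /affine/= scale0r add0r.
- by exists (aff0, nst).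
- move=> _ [[S0 S1] _ <-]/=; rewrite comb_P_affine.
  have -> : (1, - S0, - S1) = residual + (0, aff0 - S0, nst - S1).
    by rewrite residualE; apply: triple_eq; rewrite /= ?addr0// addrA addNr add0r.
  by rewrite -/(qf _ _) qf_residualD lerDl qf_ge0.
Qed.

(** The function t H - P + s splits orthogonally into minus the residual, the
part of t (H - n* ) orthogonal to the constants, and a constant. *)
Theorem dotL2_split H s :
  let f t := t *: H - Px t + s in
  let s0 := phi W A x Px - phi1 W A x H in
  dotL2 W A x f f = dot2 (T2star W A x (H - nst)) (H - nst) + Rem W A B x
    + dot2 (L2star W A x (s - s0)) (s - s0).
Proof.
move=> f s0.
have fE : f = comb (-1, s, H).
  apply/funext => t; rewrite /f /comb/= scaleN1r.
  by rewrite -addrA addrC.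
rewrite fE -/(qf _ _) dot2_T2star dot2_L2star.
have -> : (-1, s, H) = - residual + (vee (H - nst) + cst_ (s - s0)) :> triple.
  have e : aff0 - phi1 W A x (H - nst) = s0.
    by rewrite linearB /aff0 /s0 opprB addrA subrK.
  rewrite residualE; apply: triple_eq; rewrite /= ?addr0 ?opprK//.
    by rewrite addrA e addrC subrK.
  by rewrite addrC subrK.
have r0 : qf residual (vee (H - nst) + cst_ (s - s0)) = 0.
  rewrite (formDr symform_qf) residual_affine add0r residual_affine//.
rewrite (form_pythagorasN symform_qf r0) (form_pythagoras symform_qf (vee_cst _ _)).
by rewrite -RemE addrA (addrC (Rem _ _ _ _)).
Qed.

End Fiber.

(** * The reduced quadratic form at a point *)

Section ReducedForm.
Context {R : realType}.
Implicit Types (X Y : 'M[R]_2) (d : 'cV[R]_3).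

Lemma pad3_linear : linear (@pad3 R).
Proof.
move=> a u v; apply/matrixP => i j; rewrite [RHS]mxE [in RHS]mxE /pad3.
have [k ->|k ->] := @split_ordP 2 1 i; have [l ->|l ->] := @split_ordP 2 1 j;
  rewrite ?(@block_mxEul R 2 1 2 1) ?(@block_mxEur R 2 1 2 1)
    ?(@block_mxEdl R 2 1 2 1) ?(@block_mxEdr R 2 1 2 1) !mxE//; ring.
Qed.

Lemma tensor3_linear : linear (fun d => tensor3 d (@e3 R)).
Proof. by move=> a u v; rewrite /tensor3 mulmxDl scalemxAl. Qed.

Lemma tensor3E d i j : tensor3 d (@e3 R) i j = d i 0 * (j == ord_max)%:R.
Proof.
by rewrite !mxE big_ord1 !mxE eqxx andbT.
Qed.

Lemma tensor3_ul d (i j : 'I_2) : tensor3 d (@e3 R) (lshift 1 i) (lshift 1 j) = 0.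
Proof.
rewrite tensor3E; case: eqP => [/(congr1 val)/= jE|_]; last by rewrite mulr0.
by have := ltn_ord j; rewrite jE.
Qed.

Lemma sympartE n (M : 'M[R]_n) i j : sympart M i j = 2^-1 * (M i j + M j i).
Proof. by rewrite !mxE. Qed.

Lemma ul2E (M : 'M[R]_3) i j : ul2 M i j = M (lshift 1 i) (lshift 1 j).
Proof. by rewrite !mxE. Qed.

Lemma pad3_ul X (i j : 'I_2) : pad3 X (lshift 1 i) (lshift 1 j) = X i j.
Proof. exact: (@block_mxEul R 2 1 2 1). Qed.

Lemma pad3_max X (i : 'I_3) : pad3 X i ord_max = 0 /\ pad3 X ord_max i = 0.
Proof.
have -> : ord_max = rshift 2 (ord0 : 'I_1) :> 'I_3 by exact: val_inj.
have [k ->|k ->] := @split_ordP 2 1 i.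
  by rewrite (@block_mxEur R 2 1 2 1) (@block_mxEdl R 2 1 2 1) !mxE.
by rewrite !(@block_mxEdr R 2 1 2 1) !mxE.
Qed.

(** The tensor d e3^T contributes only to the last column. *)
Lemma pad3_tensor3_eq0 X d :
  sympart (pad3 X + tensor3 d e3) = 0 -> sympart X = 0 /\ d = 0.
Proof.
move=> /matrixP S0.
have E i j : (pad3 X i j + tensor3 d e3 i j) + (pad3 X j i + tensor3 d e3 j i) = 0.
  have addE (M N : 'M[R]_3) k l : (M + N) k l = M k l + N k l by rewrite mxE.
  have := S0 i j; rewrite sympartE !addE [RHS]mxE => /eqP.
  by rewrite mulf_eq0 invr_eq0 pnatr_eq0/= => /eqP.
split; last first.
  have dmax : d ord_max 0 = 0.
    by have := E ord_max ord_max; rewrite (pad3_max X ord_max).1 !tensor3E eqxx !mulr1; lra.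
  apply/colP => i; rewrite mxE; have [->//|i3] := eqVneq i ord_max.
  have := E i ord_max; rewrite (pad3_max X i).1 (pad3_max X i).2 !tensor3E.
  by rewrite eqxx dmax mul0r mulr1; lra.
apply/matrixP => i j; rewrite !mxE.
have := E (lshift 1 i) (lshift 1 j); rewrite !pad3_ul !tensor3_ul.
by rewrite !addr0 => ->; rewrite mulr0.
Qed.

Variables (W : R * R * R -> 'M[R]_3 -> R) (A : R * R -> 'M[R]_3)
  (x : R * R) (t : R) (C : R).
Local Notation h := (hess W (x, t)).
Hypotheses (Asp : sympos_mx (A x)) (hh : symform h)
  (h_ge0 : forall F, 0 <= h F F) (h_gt0 : forall F, sympart F != 0 -> 0 < h F F)
  (h_sym : forall F, h (sympart F) (sympart F) = h F F)
  (Q3_le : forall F, Q3 W (x, t) F <= C * frob (sympart F) ^+ 2).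

Lemma sympos_unit : A x \in unitmx.
Proof.
rewrite -row_free_unit; apply: inj_row_free => v vA.
have [//|v0] := eqVneq v 0.
have /(Asp.2 v^T) : v^T != 0.
  by apply: contra v0 => /eqP /(congr1 trmx); rewrite trmxK trmx0 => ->.
by rewrite -[A x]Asp.1 -trmx_mul vA trmx0 (form0r (symform_mxdot _ _)) ltxx.
Qed.

(** The change of variables in the definition of Q2. *)
Definition conj_inv (F : 'M[R]_3) : 'M[R]_3 := invmx (A x) *m F *m invmx (A x).

Lemma conj_inv_linear : linear conj_inv.
Proof.
by move=> a u v; rewrite /conj_inv mulmxDr mulmxDl -scalemxAr -scalemxAl.
Qed.

Lemma conj_inv_sympart F : sympart (conj_inv F) = conj_inv (sympart F).
Proof.
have AT : (invmx (A x))^T = invmx (A x) by rewrite trmx_inv Asp.1.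
rewrite /sympart /conj_inv !trmx_mul AT mulmxA -mulmxDl -mulmxDr.
by rewrite -scalemxAr -scalemxAl.
Qed.

Lemma conj_inv_eq0 F : conj_inv F = 0 -> F = 0.
Proof.
move=> /(congr1 (fun M => A x *m M *m A x)); rewrite /conj_inv !mulmxA.
by rewrite mulmxV ?sympos_unit// mul1mx mulmxKV ?sympos_unit// mulmx0 mul0mx.
Qed.

Definition Q2_arg X d : 'M[R]_3 := conj_inv (pad3 X + tensor3 d e3).

Lemma Q2_arg_sympart X d : sympart (Q2_arg (sympart X) d) = sympart (Q2_arg X d).
Proof.
rewrite !conj_inv_sympart; congr conj_inv.
have addE (M N : 'M[R]_3) k l : (M + N) k l = M k l + N k l by rewrite mxE.
apply/matrixP => i j; rewrite !sympartE !addE.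
suff : pad3 (sympart X) i j + pad3 (sympart X) j i = pad3 X i j + pad3 X j i by lra.
have [k ->|k ->] := @split_ordP 2 1 i; last first.
  have -> : rshift 2 k = ord_max :> 'I_3 by apply: val_inj; rewrite /= ord1.
  by rewrite (pad3_max X j).1 (pad3_max X j).2 (pad3_max _ j).1 (pad3_max _ j).2.
have [l ->|l ->] := @split_ordP 2 1 j; first by rewrite !pad3_ul !sympartE; lra.
have -> : rshift 2 l = ord_max :> 'I_3 by apply: val_inj; rewrite /= ord1.
by rewrite !(pad3_max _ (lshift 1 k)).1 !(pad3_max _ (lshift 1 k)).2.
Qed.

(** Minimizing over d projects orthogonally, with respect to the second
derivative of the density, onto the complement of the tensors d e3^T. *)
Lemma Q2_form : exists b : 'M[R]_2 -> 'M[R]_2 -> R,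
  [/\ symform b, forall X, b X X = Q2 W A x t X,
      forall X, sympart X != 0 -> 0 < b X X &
      forall X, exists d0, completed_square
        (fun d => Q3 W (x, t) (Q2_arg X d)) (Q2 W A x t X) d0].
Proof.
have jlin : linear (fun d => conj_inv (tensor3 d e3)).
  by move=> a u v; rewrite tensor3_linear conj_inv_linear.
pose j : {linear 'cV[R]_3 -> 'M[R]_3} :=
  HB.pack (fun d => conj_inv (tensor3 d e3)) (@GRing.isLinear.Build _ _ _ _ _ jlin).
have jpos d : d != 0 -> 0 < h (j d) (j d).
  move=> d0; apply: h_gt0; apply: contra d0 => /eqP.
  rewrite conj_inv_sympart => /conj_inv_eq0 S0.
  have := @pad3_tensor3_eq0 0 d; rewrite -[pad3 0](linfun_linearE pad3_linear).
  by rewrite linear0 add0r => /(_ S0)[_ ->].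
have [p [plin pP]] := form_projection hh jpos.
pose e X := conj_inv (pad3 X); pose r X := e X - j (p (e X)).
have elin : linear e by move=> a u v; rewrite /e pad3_linear conj_inv_linear.
have rlin : linear r.
  move=> a u v; rewrite /r elin plin linearP scalerBr opprD addrACA//.
have argE X d : Q2_arg X d = r X + j (d + p (e X)).
  rewrite linearD /r [j d + _]addrC addrA subrK.
  by rewrite /Q2_arg /conj_inv mulmxDr mulmxDl.
pose b X Y := h (r X) (r Y).
have sq X : completed_square (fun d => Q3 W (x, t) (Q2_arg X d)) (b X X) (- p (e X)).
  exists (fun d d' => h (j d) (j d')); split => [|d|d].
  - split=> [u v|a u v w]; first exact: hh.1.
    by rewrite linearP hh.2.
  - exact: h_ge0.
  - by rewrite -hess_Q3 argE opprK (form_pythagoras hh (pP _ _)).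
have bE X : b X X = Q2 W A x t X.
  by symmetry; apply: minimumE; exact: completed_square_minimum (sq X).
exists b; split; [|exact: bE|move=> X X0|move=> X].
- split=> [u v|a u v w]; first exact: (hh.1 (r u) (r v)).
  by rewrite /b rlin; exact: (hh.2 a (r u) (r v) (r w)).
- apply: h_gt0; apply: contra X0 => /eqP r0; apply/eqP.
  have := argE X (- p (e X)); rewrite addNr linear0 addr0 => rE.
  move: r0; rewrite -rE /Q2_arg conj_inv_sympart => /conj_inv_eq0 /pad3_tensor3_eq0.
  by case.
- by exists (- p (e X)); rewrite -bE.
Qed.

(** Both sides minimize the same function of d, as the second derivative only
sees symmetric parts. *)
Lemma Q2_sympart X : Q2 W A x t (sympart X) = Q2 W A x t X.
Proof.
have E d : Q3 W (x, t) (Q2_arg (sympart X) d) = Q3 W (x, t) (Q2_arg X d).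
  rewrite -!hess_Q3 -(h_sym (Q2_arg (sympart X) d)) -(h_sym (Q2_arg X d)).
  by rewrite Q2_arg_sympart.
exact: (congr1 (fun f => minimum [set f d | d in [set: 'cV[R]_3]]) (funext E)).
Qed.

(** The set of which L2 is a chosen element is not empty, as Q2 comes from a
symmetric bilinear form. *)
Lemma L2_spec :
  [/\ selfadjoint (L2 W A x t),
      forall Z : sym2 R, Z != 0 -> 0 < dot2 (L2 W A x t Z) Z &
      forall X, Q2 W A x t X = dot2 (L2 W A x t (to_sym2 X)) (to_sym2 X)].
Proof.
have [b [hb bE bpos _]] := Q2_form.
have [|L [Lsa LE]] := @symform_representation R (fun Z Z' => b (vsval Z) (vsval Z')).
  split=> [u v|a u v w]; first exact: (hb.1 (vsval u) (vsval v)).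
  by rewrite linearP; exact: (hb.2 a (vsval u) (vsval v) (vsval w)).
have LP : [set L : 'End(sym2 R) | selfadjoint L /\
    forall Z, Q2 W A x t (vsval Z) = dot2 (L Z) Z] L.
  by split=> // Z; rewrite LE bE.
have [sa LQ] := xgetI 0 LP; rewrite -/(L2 W A x t) in sa LQ.
split=> // [Z Z0|X]; last by rewrite -LQ vsval_to_sym2 Q2_sympart.
by rewrite -LQ -bE; apply: bpos; rewrite sympart_id ?sym2_tr.
Qed.

(** Take d = 0; the bound does not depend on t. *)
Lemma Q2_le X : Q2 W A x t X <= C * frob (sympart (conj_inv (pad3 X))) ^+ 2.
Proof.
have [b [_ _ _ /(_ X)[d0 /completed_square_minimum[_ lb]]]] := Q2_form.
have argE : Q2_arg X 0 = conj_inv (pad3 X).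
  by rewrite /Q2_arg /tensor3 mul0mx addr0.
have lb0 : Q2 W A x t X <= Q3 W (x, t) (Q2_arg X 0) by apply: lb; exists 0.
by rewrite argE in lb0; exact: le_trans lb0 (Q3_le _).
Qed.

End ReducedForm.

(** * Measurability on the plate *)

Section Plate.
Context {R : realType}.
Local Notation line := (measurableTypeR R).
Local Notation plane := (line * line)%type.
Local Notation space := (plane * line)%type.
Variables (Om : set (R * R)) (W : R * R * R -> 'M[R]_3 -> R)
  (A : R * R -> 'M[R]_3) (B : R * R * R -> 'M[R]_3).
Hypotheses (oOm : open Om) (Wadm : admissible Om W)
  (Asmooth : forall i j, smooth_upto Om (fun x => A x i j))
  (Asp : forall x, closure Om x -> sympos_mx (A x))
  (Bbd : forall i j, (fun x => B x i j) \_ (plate Om) \in Lfun leb3 +oo%E).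

Lemma measurable_Om : measurable (Om : set plane).
Proof. exact: open_measurable_plane. Qed.

Lemma measurable_plate : measurable (plate Om : set space).
Proof. exact: measurableX measurable_Om measurable_thickness. Qed.

Lemma essentially_bounded d (T : measurableType d)
    (mu : {measure set T -> \bar R}) (f : T -> R) : f \in Lfun mu +oo%E ->
  exists M, {ae mu, forall x, `|f x| <= M}.
Proof.
move=> /sub_Lfun_finLfun; rewrite inE /= /finite_norm unlock /=.
(* The norm of exponent +oo is 0 by convention when the whole space is null. *)
have [mu0|mu0] := ltP 0%E (mu setT) => hf; last first.
  exists 0; exists setT; split=> //.
  by apply/eqP; rewrite eq_le mu0 measure_ge0.
have [M hM] : exists M, (ess_sup mu (abse \o (EFin \o f)) <= M%:E)%E.
  case E : (ess_sup mu (abse \o (EFin \o f))) hf => [r| |] // _; first by exists r.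
  by exists 0; rewrite leNye.
exists M; move/ess_supP : hM; apply: filterS => z.
by rewrite /= lee_fin.
Qed.

(** Differentiability holds at every point of the plate, and W (., F) is
measurable, so D^2 W is a pointwise limit of measurable functions. *)
Lemma hess_measurable X Y :
  measurable_fun (plate Om : set space) (fun z => hess W z X Y).
Proof.
have [mW [_ _ _ [U [oU SU WC2 _]] _]] := Wadm.
have U1 : U 1%:M by exact: SU SO3_1.
have mDW F G : U G ->
    measurable_fun (plate Om : set space) (fun z => 'D_F (W z) G).
  move=> UG; apply: (@measurable_derive _ _ _ _ _ (fun z => W z) G F U) => //.
    by move=> H _; exact: mW.
  move=> z Oz; have [_ /(_ F G UG)[df _ _]] := WC2 z Oz.
  exact: df.
have mD2W F G : measurable_fun (plate Om : set space) (fun z => D2W W z 1%:M F G).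
  apply: (@measurable_derive _ _ _ _ _ (fun z F' => 'D_F (W z) F') 1%:M G U) => //.
    by move=> H; exact: mDW.
  by move=> z Oz; have [_ /(_ F _ U1)[_ _ /(_ G)[]]] := WC2 z Oz.
apply: measurable_funM; first exact: measurable_cst.
by apply: measurable_funD.
Qed.

Lemma A_measurable : measurable_mx (Om : set plane) A.
Proof.
move=> i j; apply: continuous_measurable_plane => // x Ox.
by have [_ sm _] := Asmooth i j; have [cA _] := sm [::] x Ox.
Qed.

Lemma Om_sympos x : Om x -> sympos_mx (A x).
Proof. by move=> Ox; apply/Asp/subset_closure. Qed.

Lemma B_measurable : measurable_mx (plate Om : set space) B.
Proof.
move=> i j; apply/(measurable_restrictT _ measurable_plate).
by have /sub_Lfun_mfun := Bbd i j; rewrite inE.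
Qed.

Lemma measurable_plane_fun (f : R * R -> R) (G : set space) : measurable G ->
  G `<=` plate Om -> measurable_fun (Om : set plane) f ->
  measurable_fun G (fun z => f z.1).
Proof.
move=> mG GP mf; apply: (measurable_comp (F := Om : set plane)) => //.
- exact: measurable_Om.
- by move=> _ [z /GP[Oz _] <-].
- by apply: measurable_funTS; exact: measurable_fst.
Qed.

(** One null set N collects the exceptional points of the hypotheses on W and of
the essential bounds on B. *)
Lemma good_points : exists (N : set space) (C : R) (M : 'I_3 -> 'I_3 -> R),
  [/\ measurable N, leb3 N = 0%E &
    forall z, plate Om z -> ~ N z ->
    [/\ symform (hess W z), forall F, 0 <= hess W z F F,
        forall F, sympart F != 0 -> 0 < hess W z F F,
        forall F, hess W z (sympart F) (sympart F) = hess W z F F &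
        (forall F, Q3 W z F <= C * frob (sympart F) ^+ 2) /\
        forall i j, `|B z i j| <= M i j]].
Proof.
have [_ [_ ae0 [c c0 aec] [U [oU SU WC2 _]] [C hC]]] := Wadm.
have /choice[M hM] : forall ij : 'I_3 * 'I_3, exists M : R,
    {ae leb3, forall z : space, `|((fun z => B z ij.1 ij.2) \_ (plate Om)) z| <= M}.
  by move=> ij; exact: essentially_bounded (Bbd ij.1 ij.2).
have aeM : {ae leb3, forall (z : space) ij,
    `|((fun z => B z ij.1 ij.2) \_ (plate Om)) z| <= M ij}.
  exact: filter_forall.
have [N [mN N0 hN]] : {ae leb3, forall z : space,
    [/\ plate Om z -> (forall F, 0 <= W z F) /\ (forall Q, SO3 Q -> W z Q = 0),
        plate Om z -> forall F, c * distSO3 F ^+ 2 <= W z F &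
        forall ij, `|((fun z => B z ij.1 ij.2) \_ (plate Om)) z| <= M ij]}.
  have FF : Filter (nbhs (almost_everywhere (@leb3 R))) by exact: ae_filter_ringOfSetsType.
  by apply: filterS3 ae0 aec aeM => z.
exists N, C, (fun i j => M (i, j)); split; [exact: mN|exact: N0|move=> z Oz Nz].
have /= [/(_ Oz)[W0 W1] /(_ Oz) Wd Mz] := subsetCl hN Nz.
have C_le F : Q3 W z F <= C * frob (sympart F) ^+ 2 by exact: hC.
have W1' : W z 1%:M = 0 by exact: W1 SO3_1.
split.
- exact: (symform_hess oU SU (WC2 z Oz)).
- exact: (hess_ge0 oU SU (WC2 z Oz) W0 W1').
- exact: (@hess_gt0 _ _ _ _ oU SU (WC2 z Oz) _ W0 W1' c0 Wd).
- exact: (hess_sympart oU SU (WC2 z Oz) W0 W1' C_le).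
- split; first exact: C_le.
  by move=> i j; have := Mz (i, j); rewrite patchE mem_set.
Qed.

End Plate.

(** * The limit functional at almost every point *)

Lemma completed_square_posdef (R : realType) (L : 'End(sym2 R)) c (n : sym2 R) :
  posdef L ->
  completed_square (fun s => c + dot2 (L (to_sym2 s - n)) (to_sym2 s - n)) c
    (vsval n).
Proof.
move=> [Lsa Lpos].
have linE a (u v : 'M[R]_2) : to_sym2 (a *: u + v) = a *: to_sym2 u + to_sym2 v.
  exact: to_sym2P.
exists (fun h h' => dot2 (L (to_sym2 h)) (to_sym2 h')); split.
- split=> [u v|a u v w]; first by rewrite Lsa (formC symform_dot2).
  by rewrite linE linearP symform_dot2.2.
- move=> h; have [->|h0] := eqVneq (to_sym2 h) 0; last exact/ltW/Lpos.
  by rewrite (form0r symform_dot2).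
- move=> s; congr (_ + dot2 (L _) _); last first.
  + by rewrite -[s - _]addrC -scaleN1r linE to_sym2K scaleN1r addrC.
  + by rewrite -[s - _]addrC -scaleN1r linE to_sym2K scaleN1r addrC.
Qed.

Section AlmostEverywhere.
Context {R : realType}.
Local Notation line := (measurableTypeR R).
Local Notation plane := (line * line)%type.
Local Notation space := (plane * line)%type.
Variables (Om : set (R * R)) (W : R * R * R -> 'M[R]_3 -> R)
  (A : R * R -> 'M[R]_3) (B : R * R * R -> 'M[R]_3).
Hypotheses (oOm : open Om) (Wadm : admissible Om W)
  (Asmooth : forall i j, smooth_upto Om (fun x => A x i j))
  (Asp : forall x, closure Om x -> sympos_mx (A x))
  (Bbd : forall i j, (fun x => B x i j) \_ (plate Om) \in Lfun leb3 +oo%E).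
Variables (N : set space) (C : R) (M : 'I_3 -> 'I_3 -> R).
Hypotheses (mN : measurable N)
  (goodN : forall z, plate Om z -> ~ N z ->
    [/\ symform (hess W z), forall F, 0 <= hess W z F F,
        forall F, sympart F != 0 -> 0 < hess W z F F,
        forall F, hess W z (sympart F) (sympart F) = hess W z F F &
        (forall F, Q3 W z F <= C * frob (sympart F) ^+ 2) /\
        forall i j, `|B z i j| <= M i j]).

Let G : set space := plate Om `\` N.

Let mG : measurable G.
Proof. exact: measurableD (measurable_plate oOm) mN. Qed.

Let G_plate : G `<=` plate Om. Proof. by move=> z []. Qed.

Let A_measurable_G : measurable_mx G (fun z => A z.1).
Proof.
move=> i j.
exact: (measurable_plane_fun oOm mG G_plate (A_measurable oOm Asmooth i j)).
Qed.

Let B_measurable_G : measurable_mx G B.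
Proof.
move=> i j.
exact: (measurable_funS (measurable_plate oOm) G_plate (B_measurable oOm Bbd i j)).
Qed.

Lemma measurable_mx_pad3 (X : space -> 'M[R]_2) :
  measurable_mx G X -> measurable_mx G (fun z => pad3 (X z)).
Proof.
move=> mX i j.
have cst0 : measurable_fun G (fun=> 0 : R) by exact: measurable_cst.
have [k ->|k ->] := @split_ordP 2 1 i; last first.
  have -> : rshift 2 k = ord_max :> 'I_3 by apply: val_inj; rewrite /= ord1.
  by apply: eq_measurable_fun cst0 => z _; rewrite (pad3_max (X z) j).2.
have [l ->|l ->] := @split_ordP 2 1 j.
  by apply: eq_measurable_fun (mX k l) => z _; rewrite pad3_ul.
have -> : rshift 2 l = ord_max :> 'I_3 by apply: val_inj; rewrite /= ord1.
by apply: eq_measurable_fun cst0 => z _; rewrite (pad3_max (X z) (lshift 1 k)).1.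
Qed.

Let Om_sp x : Om x -> sympos_mx (A x).
Proof. exact: Om_sympos. Qed.

Lemma Q2_measurable (X : space -> 'M[R]_2) : measurable_mx G X ->
  measurable_fun G (fun z => Q2 W A z.1 z.2 (X z)).
Proof.
move=> mX.
pose F d (z : space) := invmx (A z.1) *m (pad3 (X z) + tensor3 d e3) *m invmx (A z.1).
have mF d : measurable_mx G (F d).
  have mAinv : measurable_mx G (fun z => invmx (A z.1)).
    by apply: measurable_mx_inv => // -[x t] [[Ox _] _]; exact: sympos_unit (Om_sp Ox).
  apply: measurable_mxM => //; apply: measurable_mxM => //.
  by apply: measurable_mxD; [exact: measurable_mx_pad3|exact: measurable_mx_cst].
apply: (@measurable_minimum R _ space G 3 1
  (fun z d => Q3 W (z.1, z.2) (Q2_arg A z.1 (X z) d))) => [d|[x t] Gz].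
  apply: (@eq_measurable_fun _ _ _ _ _ (fun z => hess W z (F d z) (F d z))).
    by move=> [x t] _; rewrite hess_Q3.
  have mh Y Z : measurable_fun G (fun z => hess W z Y Z).
    exact: (measurable_funS (measurable_plate oOm) G_plate (hess_measurable Wadm Y Z)).
  have hsf z : G z -> symform (hess W z).
    by move=> [Pz Nz]; have [hh _ _ _ _] := goodN Pz Nz; exact: hh.
  exact: (measurable_form hsf mh (mF d) (mF d)).
have [[Ox _] _] := Gz; have [hh h0 hpos _ _] := goodN Gz.1 Gz.2.
have [b [_ _ _ sq]] := Q2_form (Om_sp Ox) hh h0 hpos.
exact: (sq (X (x, t))).
Qed.

Lemma measurable_fiber (F : space -> R) x : measurable_fun G F ->
  measurable_fun (xsection G x : set line) (fun t => F (x, t)).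
Proof.
move=> mF mGx Y mY.
have <- : xsection (G `&` F @^-1` Y) x = xsection G x `&` (fun t => F (x, t)) @^-1` Y.
  by apply/seteqP; split=> t; [move=> /xsectionP[? ?]; split => //; exact/xsectionP|
    move=> [/xsectionP ? ?]; exact/xsectionP].
exact: measurable_xsection (mF mG Y mY).
Qed.

(** At almost every x the section at x of the null set N is null, and the
theory across the thickness applies to the complement of that section. *)
Section AtAPoint.
Variable x : R * R.
Hypotheses (Ox : Om x) (Nx : leb1 (xsection N x) = 0%E).

Let D : set line := xsection G x.

Let DG t : D t -> G (x, t). Proof. by move=> /xsectionP. Qed.

Let mD : measurable D. Proof. exact: measurable_xsection. Qed.

Let DT : D `<=` thickness. Proof. by move=> t /DG[[]]. Qed.

Let D0 : leb1 (thickness `\` D) = 0%E.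
Proof.
apply: (@subset_measure0 _ line R leb1 _ (xsection N x)) => //.
- by apply: measurableD => //; exact: measurable_thickness.
- exact: measurable_xsection.
- move=> t [Tt Dt]; apply: contrapT => Nt; apply: Dt.
  by apply/xsectionP; split=> // Nxt; apply: Nt; exact/xsectionP.
Qed.

Let L2_good t : D t ->
  [/\ selfadjoint (L2 W A x t),
      forall Z : sym2 R, Z != 0 -> 0 < dot2 (L2 W A x t Z) Z &
      forall X, Q2 W A x t X = dot2 (L2 W A x t (to_sym2 X)) (to_sym2 X)].
Proof.
move=> /DG Gt; have [hh h0 hpos hsym _] := goodN Gt.1 Gt.2.
exact: L2_spec (Om_sp Ox) hh h0 hpos hsym.
Qed.

(* Measurability in t is inherited from joint measurability; the bound of
   Q2_le is uniform in t. *)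
Let Q2_bm X : bounded_measurable D (fun t => Q2 W A x t X).
Proof.
split.
  apply: (measurable_fiber (F := fun z => Q2 W A z.1 z.2 X)).
  by apply: Q2_measurable; exact: measurable_mx_cst.
exists (C * frob (sympart (conj_inv A x (pad3 X))) ^+ 2) => t Dt.
have [_ L2pos QL] := L2_good Dt; have Gt := DG Dt.
have [hh h0 hpos _ [Q3C _]] := goodN Gt.1 Gt.2.
rewrite ger0_norm; first exact: Q2_le (Om_sp Ox) hh h0 hpos Q3C X.
rewrite QL; have [->|X0] := eqVneq (to_sym2 X) 0; last exact/ltW/L2pos.
by rewrite (form0r symform_dot2).
Qed.

Let L2_bm Z : bm_sym2 D (fun t => L2 W A x t Z).
Proof.
move=> Y; apply: (@bm_eq _ _ (fun t => 4^-1 *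
  (Q2 W A x t (vsval (Z + Y)) + -1 * Q2 W A x t (vsval (Z - Y))))).
  move=> t Dt; have [sa _ QL] := L2_good Dt; rewrite !QL !to_sym2K mulN1r.
  have hb : symform (fun Z Z' => dot2 (L2 W A x t Z) Z').
    split=> [u v|a u v w]; first by rewrite sa (formC symform_dot2).
    by rewrite linearP symform_dot2.2.
  by rewrite (polarization hb Z Y).
apply: bmM; first exact: bm_cst.
by apply: bmD => //; apply: bmM => //; exact: bm_cst.
Qed.

Let P_bm : bm_sym2 D (P A B x).
Proof.
move=> Y; pose f (t : R) : R := \sum_(i < 2) \sum_(j < 2)
  (\sum_(k < 3) A x (lshift 1 i) k * B (x, t) k (lshift 1 j)) * vsval Y i j.
apply: (@bm_eq R D f).
  move=> t _; rewrite dot2_to_sym2 mxdotE.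
  by do 2!apply: eq_bigr => ? _; rewrite ul2E mxE.
apply: bm_sum => i; apply: bm_sum => j; apply: bmM; last exact: bm_cst.
apply: bm_sum => k; apply: bmM; first exact: bm_cst.
split; first exact: (measurable_fiber (x := x) (B_measurable_G k (lshift 1 j))).
exists (M k (lshift 1 j)) => t /DG[Pz Nz].
by have [_ _ _ _ [_ BM]] := goodN Pz Nz; exact: BM.
Qed.

Let L2_sa t : D t -> selfadjoint (L2 W A x t).
Proof. by move=> /L2_good[]. Qed.

Let L2_pos t : D t -> forall Z : sym2 R, Z != 0 -> 0 < dot2 (L2 W A x t Z) Z.
Proof. by move=> /L2_good[]. Qed.

Lemma good_integral f : \int[leb1]_(t in thickness) f t =
  \int[leb1]_(t in xsection G x : set line) f t.
Proof. exact: integral_thickness mD DT D0 f. Qed.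

Lemma good_T2star_posdef : posdef (T2star W A x).
Proof. exact: (T2star_posdef mD DT D0 L2_sa L2_pos L2_bm P_bm). Qed.

Lemma good_Rem_ge0 : 0 <= Rem W A B x.
Proof. exact: (Rem_ge0 mD DT D0 L2_sa L2_pos L2_bm P_bm). Qed.

Lemma good_Rem_affine_projection :
  (exists2 p : R -> sym2 R, affine_proj W A x (P A B x) p &
     Rem W A B x = dotL2 W A x (P A B x \- p) (P A B x \- p)) /\
  is_minimum
    [set dotL2 W A x (P A B x \- affine S.1 S.2) (P A B x \- affine S.1 S.2)
    | S in [set: sym2 R * sym2 R]] (Rem W A B x).
Proof. exact: (Rem_affine_projection mD DT D0 L2_sa L2_pos L2_bm P_bm). Qed.

(** The integral is the squared norm of t sym K - P + sym s, which dotL2_split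
turns into a completed square in s. *)
Lemma good_energy_density (K : 'M[R]_2) : exists s0,
  completed_square (fun s => \int[leb1]_(t in thickness)
      Q2 W A x t (t *: K - ul2 (A x *m B (x, t)) + s))
    (dot2 (T2star W A x (to_sym2 K - nstar W A B x)) (to_sym2 K - nstar W A B x)
      + Rem W A B x) s0.
Proof.
set c := _ + Rem _ _ _ _.
pose s0 := phi W A x (P A B x) - phi1 W A x (to_sym2 K).
exists (vsval s0).
have := completed_square_posdef c s0 (L2star_posdef mD DT D0 L2_sa L2_pos L2_bm P_bm).
rewrite (_ : (fun s => _ + _) = (fun s => \int[leb1]_(t in thickness)
      Q2 W A x t (t *: K - ul2 (A x *m B (x, t)) + s)))//.
apply/funext => s; rewrite -(dotL2_split mD DT D0 L2_sa L2_pos L2_bm P_bm).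
apply: (eq_integral_thickness mD DT D0) => t /L2_good[_ _ ->].
suff -> : to_sym2 (t *: K - ul2 (A x *m B (x, t)) + s) =
    t *: to_sym2 K - P A B x t + to_sym2 s by [].
apply: val_inj; rewrite /P !linearE/= !vsval_to_sym2.
by apply/matrixP => i j; rewrite !mxE; ring.
Qed.

End AtAPoint.

(** E stands for Omega minus a null set. *)
Variable E : set plane.
Hypotheses (EOm : E `<=` Om)
  (EN : forall x, E x -> leb1 (xsection N x) = 0%E).

Lemma energy_measurable (K : plane -> 'M[R]_2) s : measurable_mx (Om : set plane) K ->
  measurable_fun E (fun x => \int[leb1]_(t in thickness)
    Q2 W A x t (t *: K x - ul2 (A x *m B (x, t)) + s)).
Proof.
move=> mK.
pose X (z : space) := z.2 *: K z.1 - ul2 (A z.1 *m B z) + s.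
have mX : measurable_mx G X.
  apply: measurable_mxD; last exact: measurable_mx_cst.
  apply: measurable_mxB.
    apply: measurable_mxZ; first by apply: measurable_funTS; exact: measurable_snd.
    by move=> i j; exact: (measurable_plane_fun oOm mG G_plate (mK i j)).
  move=> i j; have := measurable_mxM A_measurable_G B_measurable_G (lshift 1 i) (lshift 1 j).
  by apply: eq_measurable_fun => z _; rewrite ul2E.
have mF := Q2_measurable mX.
have F0 z : G z -> 0 <= Q2 W A z.1 z.2 (X z).
  case: z => x t [Pz Nz]; have [hh h0 hpos hsym _] := goodN Pz Nz.
  have [Ox _] := Pz.
  have [_ L2pos ->] := L2_spec (Om_sp Ox) hh h0 hpos hsym.
  have [->|Z0] := eqVneq (to_sym2 (X (x, t))) 0; last exact/ltW/L2pos.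
  by rewrite (form0r symform_dot2).
have mI := measurable_integral_xsection mG mF F0.
have mfI := measurableT_comp (fine_measurable measurableT) mI.
apply: eq_measurable_fun (measurable_funS measurableT (@subsetT _ E) mfI) => x.
by rewrite inE => Ex; rewrite (good_integral (EOm Ex) (EN Ex)).
Qed.

Lemma energy_density_measurable (K : plane -> 'M[R]_2) :
  measurable_mx (Om : set plane) K ->
  measurable_fun E (fun x =>
    dot2 (T2star W A x (to_sym2 (K x) - nstar W A B x)) (to_sym2 (K x) - nstar W A B x)
    + Rem W A B x).
Proof.
move=> mK.
apply: (@measurable_minimum R _ plane E 2 2 (fun x s => \int[leb1]_(t in thickness)
    Q2 W A x t (t *: K x - ul2 (A x *m B (x, t)) + s))) => [s|x Ex].
  exact: energy_measurable.
exact: (good_energy_density (EOm Ex) (EN Ex) (K x)).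
Qed.

(** The remainder is the least energy density over all H, attained at n*. *)
Lemma Rem_measurable : measurable_fun E (fun x => Rem W A B x).
Proof.
apply: (@measurable_minimum R _ plane E 2 2 (fun x H =>
    dot2 (T2star W A x (to_sym2 H - nstar W A B x)) (to_sym2 H - nstar W A B x)
    + Rem W A B x)) => [H|x Ex].
  by apply: energy_density_measurable; exact: measurable_mx_cst.
exists (vsval (nstar W A B x)).
have := completed_square_posdef (Rem W A B x) (nstar W A B x)
  (good_T2star_posdef (EOm Ex) (EN Ex)).
by under eq_fun do rewrite addrC.
Qed.

End AlmostEverywhere.

Section Gradient.
Context {R : realType}.
Local Notation line := (measurableTypeR R).
Local Notation plane := (line * line)%type.

Lemma wpartial_measurable (Om : set (R * R)) i f :
  measurable_fun (Om : set plane) (wpartial Om i f).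
Proof.
rewrite /wpartial; case: xgetP => [g -> [_ [mg _] _]|_]; first exact: mg.
exact: measurable_cst.
Qed.

Lemma grad_measurable (Om : set (R * R)) y :
  measurable_mx (Om : set plane) (grad Om y).
Proof.
move=> k i.
have -> : (fun x => grad Om y x k i) = wpartial Om i (fun z => y z k 0).
  by apply/funext => x; rewrite mxE.
exact: wpartial_measurable.
Qed.

End Gradient.

Theorem mainTheorem4 (R : realType) (Om : set (R * R))
    (W : R * R * R -> 'M[R]_3 -> R)
    (A : R * R -> 'M[R]_3) (B : R * R * R -> 'M[R]_3)
    (y : R * R -> 'cV[R]_3) :
  open Om -> bounded_set Om -> connected Om -> piecewise_C1_boundary Om ->
  admissible Om W ->
  (forall i j, smooth_upto Om (fun x => A x i j)) ->
  (forall x, closure Om x -> sympos_mx (A x)) ->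
  (forall i j, (fun x => B x i j) \_ (plate Om) \in Lfun leb3 +oo%E) ->
  {ae leb3, forall x, plate Om x -> sym_mx (B x)} ->
  in_W22_R3 Om y ->
  {ae leb2, forall x, Om x ->
    (grad Om y x)^T *m grad Om y x = ul2 (metric A x)} ->
  [/\ {ae leb2, forall x, Om x -> posdef (T2star W A x)},
      energy Om W A B y =
        ((2^-1)%:E * \int[leb2]_(x in Om)
          (dot2 (T2star W A x (Hsym Om A y x - nstar W A B x))
                (Hsym Om A y x - nstar W A B x))%:E
         + (2^-1)%:E * \int[leb2]_(x in Om) (Rem W A B x)%:E)%E &
      {ae leb2, forall x, Om x ->
        (exists2 p : R -> sym2 R,
            affine_proj W A x (P A B x) p &
            Rem W A B x = dotL2 W A x (P A B x \- p) (P A B x \- p)) /\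
        is_minimum
          [set dotL2 W A x (P A B x \- affine S.1 S.2)
                           (P A B x \- affine S.1 S.2)
          | S in [set: sym2 R * sym2 R]]
          (Rem W A B x)}].
Proof.
move=> oOm _ _ _ Wadm Asmooth Asp Bbd _ _ _.
pose H x := Hsym Om A y x; pose n x := nstar W A B x.
pose T x := dot2 (T2star W A x (H x - n x)) (H x - n x).
have [N [C [M [mN N0 goodN]]]] := good_points Wadm Bbd.
have [N2 [mN2 N20 hN2]] := null_xsections mN N0.
have mOm := measurable_Om oOm.
pose E : set (measurableTypeR R * measurableTypeR R) := Om `\` N2.
have mE : measurable E by exact: measurableD.
have EOm : E `<=` Om by move=> x [].
have EN x : E x -> leb1 (xsection N x) = 0%E by move=> [_ /(subsetCl hN2)].
have aeE (Q : R * R -> Prop) : (forall x, E x -> Q x) ->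
    {ae leb2, forall x, Om x -> Q x}.
  move=> EQ; exists N2; split=> // x /= /not_implyP[Ox Qx].
  by apply: contrapT => Nx; apply/Qx/EQ.
have intE (f : R * R -> \bar R) :
    (\int[leb2]_(x in Om) f x = \int[leb2]_(x in E) f x)%E.
  exact: integral_setD_null.
split.
- by apply: aeE => x Ex; exact: (good_T2star_posdef oOm Wadm Asmooth Asp Bbd mN goodN (EOm x Ex) (EN x Ex)).
- have T0 x : E x -> 0 <= T x.
    move=> Ex; rewrite /T; set Z := H x - n x.
    have [_ Tpos] := good_T2star_posdef oOm Wadm Asmooth Asp Bbd mN goodN (EOm x Ex) (EN x Ex).
    have [->|Z0] := eqVneq Z 0; last exact/ltW/Tpos.
    by rewrite (form0r (@symform_dot2 R)).
  have Rem0 x : E x -> 0 <= Rem W A B x.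
    by move=> Ex; exact: (good_Rem_ge0 oOm Wadm Asmooth Asp Bbd mN goodN (EOm x Ex) (EN x Ex)).
  have mRem := Rem_measurable oOm Wadm Asmooth Asp Bbd mN goodN EOm EN.
  have mH : measurable_mx (Om : set (measurableTypeR R * measurableTypeR R))
      (fun x => (grad Om y x)^T *m grad Om (cosserat Om A y) x).
    by apply: measurable_mxM; [apply: measurable_mx_tr|]; exact: grad_measurable.
  have mTRem : measurable_fun E (fun x => T x + Rem W A B x).
    exact: (energy_density_measurable oOm Wadm Asmooth Asp Bbd mN goodN EOm EN mH).
  have mT : measurable_fun E T.
    apply: eq_measurable_fun (measurable_funB mTRem mRem) => x _ /=.
    by rewrite addrK.
  have TE0 x : E x -> (0 <= (T x)%:E)%E by move=> /T0; rewrite lee_fin.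
  have RE0 x : E x -> (0 <= (Rem W A B x)%:E)%E by move=> /Rem0; rewrite lee_fin.
  have mTE : measurable_fun E (EFin \o T) by exact/measurable_EFinP.
  have mRE : measurable_fun E (fun x => (Rem W A B x)%:E) by exact/measurable_EFinP.
  rewrite /energy !intE -ge0_muleDr; [|exact: integral_ge0 TE0|exact: integral_ge0 RE0].
  congr (_ * _)%E; rewrite -(ge0_integralD leb2 mE TE0 mTE RE0 mRE).
  apply: eq_integral => x; rewrite inE => Ex; congr (_%:E).
  have [s0 /completed_square_minimum/minimumE ->//] :=
    good_energy_density oOm Wadm Asmooth Asp Bbd mN goodN (EOm x Ex) (EN x Ex)
      ((grad Om y x)^T *m grad Om (cosserat Om A y) x).
- by apply: aeE => x Ex; exact: (good_Rem_affine_projection oOm Wadm Asmooth Asp Bbd mN goodN (EOm x Ex) (EN x Ex)).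
Qed.
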